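(* There are absolute constants $c,\eta>0$ such that, for every prime $p\ge7$, $$\left|\left\{\frac1{n+1}\binom{2n}{n}\bmod p:\ 0\le n\le\frac{p-1}{2}\right\}\right|\ge c\,p^{1/2+\eta}$$ and $$\left|\left\{\binom{2n}{n}\bmod p:\ 0\le n\le\frac{p-1}{2}\right\}\right|\ge c\,p^{1/2+\eta}.$$ *)

(* Defs.v *)
From HB Require Import structures.
From mathcomp Require Import all_boot all_order all_algebra.
From mathcomp Require Import reals exp.

Set Implicit Arguments.
Unset Strict Implicit.
Unset Printing Implicit Defensive.

(* The quotient is exact: see [catalan_mul]. *)
Definition catalan (n : nat) : nat := 'C(2 * n, n) %/ n.+1.

Lemma catalan_mul (n : nat) : catalan n * n.+1 = 'C(2 * n, n).
Proof.
apply: divnK; rewrite -(@Gauss_dvdr _ n) ?coprimeSn //.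
have := mul_bin_left (2 * n) n; rewrite mul2n -addnn addnK => <-.
exact: dvdn_mulr.
Qed.

(* For prime p, 'F_p is the field of residues mod p, and k%:R : 'F_p is the
   residue of k; n <= (p - 1) / 2 is encoded as n < ((p - 1) / 2) + 1. *)
Definition residues (p : nat) (u : nat -> nat) : {set 'F_p} :=
  [set ((u n)%:R : 'F_p)%R | n : 'I_((p.-1 %/ 2).+1)].

(* Main.v *)
(* Write N for the number of residues and suppose N^2 <= K p. Three consecutive
   terms a, b, c satisfy (x - b)(y - b) = k b^2, where x and y are fixed dilates
   of a and c and k <> 0, 1 is fixed: for each residue b, an involutive Moebius
   map [step b] sends x to y. The ratios b / a are pairwise distinct, so about
   N^2 / K of the pairs (x, b) stay inside the residue set, and hence about N^3 of
   the products step b o step c o step d send N of the residues to residues. Such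
   a product determines (b, c, d) up to boundedly many choices, so these are about
   N^3 different Moebius maps. Sending one point and its image to infinity leaves
   about N^2 affine maps, each with N coincidences between two sets of size N.
   Restricting these maps to two points gives about N ratios l for which
   l y1 + (1 - l) y2 stays in a set Y of size N for most y1, y2 in Y.

   Balog-Szemeredi-Gowers and the Ruzsa triangle inequality then give one set U
   and about N numbers s with #|U - s U| = O(N), up to powers of K. By
   Pluennecke's inequality the set of such s is almost stable under the field
   operations, and because 'F_p has no proper subfield it therefore contains
   about min(N^2, p) elements; the average of the additive energy of U and s U
   over so many s is too small. All losses are powers of K, so p <= K^e. *)
Require Import Defs.
From HB Require Import structures.
From mathcomp Require Import all_boot all_order all_algebra.
From mathcomp Require Import reals exp.
From mathcomp Require Import zify ring.

Set Implicit Arguments.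
Unset Strict Implicit.
Unset Printing Implicit Defensive.
Import Order.TTheory GRing.Theory Num.Theory.

(** * Double counting and averaging over finite sets *)

Lemma card_le_fibers (S T : finType) (A : {set S}) (D : {set T}) (f : S -> T)
    (m : nat) :
  {in A, forall a, f a \in D} ->
  {in D, forall z, #|[set a in A | f a == z]| <= m} -> #|A| <= m * #|D|.
Proof.
move=> fAD fib; rewrite -sum1_card (partition_big f (mem D)) //=.
rewrite mulnC -sum_nat_const; apply: leq_sum => z zD.
by rewrite sum1dep_card; apply: leq_trans (fib z zD); rewrite subset_leq_card //;
  apply/subsetP => a; rewrite !inE.
Qed.

Lemma pigeonhole (S T : finType) (A : {set S}) (D : {set T}) (f : S -> T) :
  0 < #|A| -> {in A, forall a, f a \in D} ->
  exists2 z, z \in D & #|A| <= #|D| * #|[set a in A | f a == z]|.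
Proof.
move=> A0 fAD; apply/exists_inP; case: exists_inP => // small0; exfalso.
have small z : z \in D -> ~~ (#|A| <= #|D| * #|[set a in A | f a == z]|).
  by move=> zD; apply/negP => zA; apply: small0; exists z.
have D0 : 0 < #|D|.
  by case/card_gt0P: A0 => a /fAD aD; apply/card_gt0P; exists (f a).
have := leqnn (#|D| * #|A|); apply/negP; rewrite -ltnNge.
have EA : #|A| = \sum_(z in D) \sum_(a in A | f a == z) 1.
  by rewrite -sum1_card (partition_big f (mem D)).
rewrite {1}EA big_distrr /= -sum_nat_const.
case/card_gt0P: D0 => z0 z0D.
have E z : z \in D -> #|D| * (\sum_(a in A | f a == z) 1) < #|A|.
  move=> zD; rewrite ltnNge; apply: contra (small z zD).
  by rewrite sum1dep_card.
rewrite (bigD1 z0) //= [X in _ < X](bigD1 z0) //=.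
rewrite -addSn; apply: leq_add; first exact: E.
by apply: leq_sum => z /andP[zD _]; apply: ltnW; apply: E.
Qed.

Lemma sum_exists_le (T : finType) (D : {set T}) (f : T -> nat) :
  0 < #|D| -> exists2 z, z \in D & \sum_(i in D) f i <= #|D| * f z.
Proof.
case/card_gt0P=> z0 z0D; case: (arg_maxnP f z0D) => z zD zmax.
by exists z => //; rewrite -sum_nat_const; apply: leq_sum => i; apply: zmax.
Qed.

Lemma cauchy_schwarz_nat (T : finType) (D : {set T}) (f : T -> nat) :
  (\sum_(i in D) f i) ^ 2 <= #|D| * \sum_(i in D) f i ^ 2.
Proof.
rewrite -(leq_pmul2l (isT : 0 < 2)).
have -> : 2 * (\sum_(i in D) f i) ^ 2
   = \sum_(i in D) \sum_(j in D) (2 * (f i * f j)).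
  rewrite expnS expn1 big_distrl big_distrr /=; apply: eq_bigr => i _.
  by rewrite !big_distrr.
have -> : 2 * (#|D| * \sum_(i in D) f i ^ 2)
   = \sum_(i in D) \sum_(j in D) (f i ^ 2 + f j ^ 2).
  under [RHS]eq_bigr => i _ do rewrite big_split /= sum_nat_const.
  by rewrite big_split /= -big_distrr /= sum_nat_const addnn mul2n.
by apply: leq_sum => i _; apply: leq_sum => j _; apply: nat_Cauchy.
Qed.

(** Indices with [a * f i < b] contribute at most [m * b] to the left side. In each use [m * b] is
    at most half of the left side, so the popular indices carry the rest. *)
Lemma sum_popular (T : finType) (D : {set T}) (f : T -> nat) (m a b : nat) :
  #|D| <= m ->
  a * \sum_(i in D) f i
    <= m * b + a * \sum_(i in [set i in D | b <= a * f i]) f i.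
Proof.
move=> Dm; rewrite (bigID (fun i => b <= a * f i)) /= mulnDr addnC.
apply: leq_add.
  rewrite big_distrr /=.
  apply: (@leq_trans (\sum_(i in D | ~~ (b <= a * f i)) b)).
    by apply: leq_sum => i /andP[_]; rewrite -ltnNge => /ltnW.
  apply: (@leq_trans (\sum_(i in D) b)); last by rewrite sum_nat_const leq_mul.
  by rewrite [X in _ <= X](bigID (fun i => ~~ (b <= a * f i))) leq_addr.
by apply/eq_leq; congr (_ * _); apply: eq_bigl => i; rewrite inE.
Qed.

Lemma sum_card_exchange (T1 T2 : finType) (D1 : {set T1}) (D2 : {set T2})
    (e : T1 -> T2 -> bool) :
  \sum_(x in D1) #|[set y in D2 | e x y]|
    = \sum_(y in D2) #|[set x in D1 | e x y]|.
Proof.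
have E (T : finType) (D : {set T}) (P : pred T) :
    #|[set y in D | P y]| = \sum_(y in D) P y.
  rewrite -sum1_card (eq_bigl (fun y => (y \in D) && P y)); last first.
    by move=> y; rewrite inE.
  by rewrite big_mkcondr; apply: eq_bigr => y _; case: (P y).
under eq_bigr => x _ do rewrite E.
by rewrite exchange_big /=; apply: eq_bigr => y _; rewrite E.
Qed.

Lemma card_dep_pair (S T : finType) (A : {set S}) (B : S -> {set T}) :
  #|[set z : S * T | (z.1 \in A) && (z.2 \in B z.1)]| = \sum_(x in A) #|B x|.
Proof.
rewrite -sum1_card (eq_bigl (fun z : S * T =>
  (z.1 \in A) && (z.2 \in B z.1))); last by move=> z; rewrite inE.
rewrite -(pair_big_dep (mem A) (fun x y => y \in B x) (fun _ _ => 1)) /=.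
by apply: eq_bigr => x _; rewrite sum1_card.
Qed.

(** * Balog-Szemeredi-Gowers and sumsets *)

(** Gowers's dependent choice: among the neighbours of a well chosen vertex [y0], few pairs have few
    common neighbours. [X'] keeps those with few bad partners, [Y'] the vertices with many
    neighbours in [X']. For a path [x - y1 - x1 - y], first pick a neighbour [x1] of [y] that forms
    no bad pair with [x], then a common neighbour [y1] of [x] and [x1]. *)
Lemma bsg_paths (T1 T2 : finType) (e : T1 -> T2 -> bool) (X : {set T1})
    (Y : {set T2}) (N K : nat) :
  0 < N -> #|X| <= N -> #|Y| <= N ->
  N ^ 2 <= K * \sum_(x in X) #|[set y in Y | e x y]| ->
  exists X' : {set T1}, exists Y' : {set T2},
    [/\ X' \subset X, Y' \subset Y, N <= 6 * K * #|X'|, N <= 4 * K * #|Y'| &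
      forall x y, x \in X' -> y \in Y' ->
        N ^ 2 <= 48 * 512 * K ^ 5 * #|[set z : T1 * T2 |
          [&& z.1 \in X, z.2 \in Y, e x z.2, e z.1 z.2 & e z.1 y]]| ].
Proof.
move=> N0 XN YN dense.
have K0 : 0 < K by case: K dense => // /=; lia.
pose deg x := #|[set y in Y | e x y]|.
pose X1 := [set x in X | N <= 2 * K * deg x].
pose nb y := [set x in X1 | e x y].
(* The value of [m] serves [Gn]: at most [n / (16 K)] points of [Z] are bad for [x], while [y] has
   at least [n / (8 K)] neighbours in [X']. The value of [L] makes the bad pairs negligible against
   the second moment in [S2] when [y0] is chosen. *)
pose m := 32 * K; pose L := 16 * K ^ 2 * m.
pose bad (z : T1 * T1) := #|[set y in Y | e z.1 y && e z.2 y]| * L < N.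
pose Bs := [set z in setX X1 X1 | bad z].
pose B y := #|[set z in Bs | e z.1 y && e z.2 y]|.
have X1X : X1 \subset X by apply/subsetP => x; rewrite inE => /andP[].
have X1N : #|X1| <= N by apply: leq_trans XN; apply: subset_leq_card.
have S1 : N ^ 2 <= 2 * K * \sum_(y in Y) #|nb y|.
  rewrite -(sum_card_exchange X1 Y e) (eq_bigr deg) //.
  have := @sum_popular _ X deg N (2 * K) N XN; rewrite -/X1.
  move: dense; rewrite (eq_bigr deg) //.
  move: (\sum_(x in X) _) (\sum_(x in X1) _) => a b; nia.
have S2 : N ^ 3 <= 4 * K ^ 2 * \sum_(y in Y) #|nb y| ^ 2.
  have := @cauchy_schwarz_nat _ Y (fun y => #|nb y|).
  move: (\sum_(y in Y) #|nb y|) (\sum_(y in Y) #|nb y| ^ 2) S1 => a b S1 cs.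
  have h : (N ^ 2) ^ 2 <= (2 * K * a) ^ 2 by rewrite (leq_exp2r _ _ (isT : 0 < 2)).
  have h2 : #|Y| * b <= N * b by rewrite leq_mul2r YN orbT.
  have h3 : K ^ 2 * a ^ 2 <= K ^ 2 * (N * b).
    by rewrite leq_mul2l (leq_trans cs h2) orbT.
  rewrite -(leq_pmul2l N0); lia.
have SB : 16 * K ^ 2 * m * \sum_(y in Y) B y <= N ^ 3.
  rewrite -(sum_card_exchange Bs Y (fun z y => e z.1 y && e z.2 y)).
  rewrite -/L big_distrr /=.
  apply: (@leq_trans (\sum_(z in Bs) N)).
    apply: leq_sum => z; rewrite inE => /andP[_].
    by rewrite /bad mulnC => /ltnW.
  rewrite sum_nat_const expnSr leq_mul2r; apply/orP; right.
  apply: (@leq_trans #|setX X1 X1|).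
    by apply: subset_leq_card; apply/subsetP => z; rewrite inE => /andP[].
  by rewrite cardsX -mulnn leq_mul.
(* Averaging over [Y] with [S2] and [SB]. This single inequality makes the neighbourhood of [y0]
   large ([n3]) and its bad pairs rare ([mB]). *)
have [y0 y0Y y0P] : exists2 y, y \in Y &
    N ^ 2 + 8 * K ^ 2 * m * B y <= 8 * K ^ 2 * #|nb y| ^ 2.
  apply/exists_inP; case: exists_inP => // no; exfalso.
  have lt y : y \in Y ->
      8 * K ^ 2 * #|nb y| ^ 2 <= N ^ 2 + 8 * K ^ 2 * m * B y.
    by move=> yY; rewrite leqNgt; apply/negP => /ltnW h; apply: no; exists y.
  have : 8 * K ^ 2 * \sum_(y in Y) #|nb y| ^ 2
         <= N ^ 3 + 8 * K ^ 2 * m * \sum_(y in Y) B y.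
    rewrite !big_distrr /=; apply: leq_trans; first by apply: leq_sum lt.
    rewrite big_split /= leq_add2r sum_nat_const [N ^ 3]expnS.
    by rewrite leq_mul2r YN orbT.
  have : 0 < N ^ 3 by rewrite expn_gt0 N0.
  move: S2 SB; move: (\sum_(y in Y) #|nb y| ^ 2) (\sum_(y in Y) B y) => a b; lia.
pose Z := nb y0; pose n := #|Z|.
have ZX1 : Z \subset X1 by apply/subsetP => x; rewrite inE => /andP[].
have n3 : N <= 3 * K * n.
  rewrite -(leq_exp2r _ _ (isT : 0 < 2)).
  move: y0P; rewrite -/Z -/n; lia.
have mB : m * B y0 <= n ^ 2.
  have K2 : 0 < 8 * K ^ 2 by rewrite muln_gt0 expn_gt0 K0.
  by rewrite -(leq_pmul2l K2); move: y0P; rewrite -/Z -/n; lia.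
have n0 : 0 < n by rewrite lt0n; apply/eqP => n00; move: n3; rewrite n00; lia.
pose badc x := #|[set x' in Z | bad (x, x')]|.
pose X' := [set x in Z | m * badc x <= 2 * n].
have X'Z : X' \subset Z by apply/subsetP => x; rewrite inE => /andP[].
have sumbad : \sum_(x in Z) badc x <= B y0.
  rewrite -(card_dep_pair Z (fun x => [set x' in Z | bad (x, x')])) /B.
  apply: subset_leq_card; apply/subsetP => -[a b].
  rewrite in_set => /andP[/= aZ /setIdP[bZ hb]].
  have [aX1 ea] : a \in X1 /\ e a y0 by move: aZ; rewrite in_set => /andP[].
  have [bX1 eb] : b \in X1 /\ e b y0 by move: bZ; rewrite in_set => /andP[].
  by rewrite inE /= ea eb andbT inE in_setX aX1 bX1 /= andbT.
have X'n : n <= 2 * #|X'|.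
  have : 2 * n * #|Z :\: X'| <= m * \sum_(x in Z) badc x.
    rewrite big_distrr /= (big_setID X') /=.
    apply: leq_trans (leq_addl _ _).
    rewrite mulnC -sum_nat_const; apply: leq_sum => x.
    by rewrite !inE negb_and => /andP[/orP[/negP //|]] + _; rewrite -ltnNge => /ltnW.
  have := cardsID X' Z; rewrite (setIidPr X'Z) -/n.
  move: sumbad mB; move: (\sum_(x in Z) _) (B y0) (#|Z :\: X'|) (#|X'|).
  clear; move=> *; nia.
have X'X1 : X' \subset X1 by apply: subset_trans X'Z ZX1.
pose nb' y := [set x in X' | e x y].
pose Y' := [set y in Y | #|X'| <= 4 * K * #|nb' y|].
have SX' : N * #|X'| <= 2 * K * \sum_(y in Y) #|nb' y|.
  rewrite -(sum_card_exchange X' Y e) big_distrr /= mulnC -sum_nat_const.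
  apply: leq_sum => x /(subsetP X'X1); rewrite inE => /andP[_].
  exact.
exists X', Y'; split.
- by apply: subset_trans X'X1 X1X.
- by apply/subsetP => y; rewrite inE => /andP[].
- nia.
- have := @sum_popular _ Y (fun y => #|nb' y|) N (4 * K) #|X'| YN.
  rewrite -/Y'.
  have : \sum_(y in Y') #|nb' y| <= #|Y'| * #|X'|.
    rewrite -sum_nat_const; apply: leq_sum => y _; apply: subset_leq_card.
    by apply/subsetP => x; rewrite inE => /andP[].
  have X'0 : 0 < #|X'| by lia.
  rewrite -(leq_pmul2r X'0).
  move: SX'; move: (\sum_(y in Y) #|nb' y|) (\sum_(y in Y') #|nb' y|) => a b; nia.
move=> x y xX' yY'.
pose G := [set x1 in nb' y | ~~ bad (x, x1)].
have Gn : n <= 16 * K * #|G|.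
  have : #|X'| <= 4 * K * #|nb' y| by move: yY'; rewrite inE => /andP[].
  have : m * badc x <= 2 * n by move: xX'; rewrite inE => /andP[].
  have : #|nb' y| <= badc x + #|G|.
    rewrite -(cardsID [set x1 | bad (x, x1)] (nb' y)); apply: leq_add.
      apply: subset_leq_card; apply/subsetP => x1; rewrite in_setI => /andP[].
      rewrite [x1 \in nb' y]inE => /andP[/(subsetP X'Z) x1Z _]; rewrite inE => hb.
      by rewrite inE x1Z hb.
    apply: subset_leq_card; apply/subsetP => x1; rewrite in_setD => /andP[].
    by rewrite inE => hb x1nb; rewrite inE x1nb.
  rewrite /m; move: (badc x) (#|nb' y|) (#|G|) (#|X'|) X'n => *; nia.
set P := [set z | _].
have PG : \sum_(x1 in G) #|[set y1 in Y | e x y1 && e x1 y1]| <= #|P|.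
  rewrite -(card_dep_pair G (fun x1 => [set y1 in Y | e x y1 && e x1 y1])).
  apply: subset_leq_card; apply/subsetP => -[x1 y1]; rewrite in_set.
  case/andP => /= /setIdP[/setIdP[x1X' x1y] _] /setIdP[y1Y /andP[xy1 x1y1]].
  by rewrite inE /= y1Y xy1 x1y1 x1y (subsetP X1X _ (subsetP X'X1 _ x1X')).
have : N * #|G| <= L * #|P|.
  apply: (@leq_trans (L * \sum_(x1 in G) #|[set y1 in Y | e x y1 && e x1 y1]|)).
    rewrite mulnC -sum_nat_const big_distrr /=; apply: leq_sum => x1.
    by rewrite inE => /andP[_]; rewrite /bad /= -leqNgt mulnC.
  by rewrite leq_mul2l PG orbT.
rewrite /L /m; move: (#|P|) (#|G|) Gn => q g Gn NG.
have h1 : N * N <= 3 * K * (16 * K * g) * N.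
  rewrite leq_mul2r; apply/orP; right; apply: (leq_trans n3).
  by rewrite leq_mul2l Gn orbT.
have h2 : K ^ 2 * (N * g) <= K ^ 2 * (16 * K ^ 2 * (32 * K) * q).
  by rewrite leq_mul2l NG orbT.
have -> : N ^ 2 = N * N by rewrite mulnn.
apply: (leq_trans h1).
have -> : 3 * K * (16 * K * g) * N = 48 * (K ^ 2 * (N * g)) by ring.
apply: (@leq_trans (48 * (K ^ 2 * (16 * K ^ 2 * (32 * K) * q)))).
  by rewrite leq_mul2l h2 orbT.
apply: eq_leq; ring.
Qed.

Definition sumset (F : finZmodType) (A B : {set F}) : {set F} :=
  [set (a + b)%R | a in A, b in B].

Definition dilate (F : finFieldType) (c : F) (A : {set F}) : {set F} :=
  [set (c * a)%R | a in A].

Definition comb (F : finFieldType) (a : F) (U : {set F}) (b : F)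
    (V : {set F}) : {set F} := sumset (dilate a U) (dilate b V).

Arguments dilate {F} c%_ring_scope A.
Arguments comb {F} a%_ring_scope U b%_ring_scope V.

Section Sumset.
Variable F : finZmodType.
Implicit Types A B C X Y Z : {set F}.
Local Open Scope ring_scope.

Lemma sumsetP A B x :
  reflect (exists a b, [/\ a \in A, b \in B & x = a + b]) (x \in sumset A B).
Proof.
apply: (iffP imset2P) => [[a b aA bB ->]|[a [b [aA bB ->]]]]; last by exists a b.
by exists a, b.
Qed.

Lemma mem_sumset A B a b : a \in A -> b \in B -> a + b \in sumset A B.
Proof. by move=> aA bB; apply/imset2P; exists a b. Qed.

Lemma sumsetC A B : sumset A B = sumset B A.
Proof.
by apply/setP => x; apply/sumsetP/sumsetP => -[a [b [? ? ->]]]; exists b, a;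
  rewrite addrC.
Qed.

Lemma sumsetA A B C : sumset A (sumset B C) = sumset (sumset A B) C.
Proof.
apply/setP => x; apply/sumsetP/sumsetP.
- case=> a [y [aA /sumsetP[b [c [bB cC ->]]] ->]].
  by exists (a + b), c; rewrite mem_sumset // addrA.
- case=> y [c [/sumsetP[a [b [aA bB ->]]] cC ->]].
  by exists a, (b + c); rewrite mem_sumset // addrA.
Qed.

Lemma sumsetS A A' B B' :
  A \subset A' -> B \subset B' -> sumset A B \subset sumset A' B'.
Proof. by move=> sA sB; apply: imset2S. Qed.

Lemma card_sumset1 A b : #|sumset A [set b]| = #|A|.
Proof.
have -> : sumset A [set b] = (fun x => x + b) @: A.
  apply/setP => x; apply/sumsetP/imsetP.
    by case=> a [c [aA /set1P -> ->]]; exists a.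
  by case=> a aA ->; exists a, b; rewrite set11.
by rewrite card_imset //; apply: addIr.
Qed.

(** Fix one representation [w = x + z] of each [w] in [X + Z]. Then [(w, y)] is sent injectively to
    [(x + y, - y + z)]: the two coordinates add up to [w], which gives [x] and then [y]. *)
Lemma ruzsa_triangle X Y Z :
  (#|sumset X Z| * #|Y| <= #|sumset X Y| * #|sumset (-%R @: Y) Z|)%N.
Proof.
pose h w := odflt (0, 0) [pick z in setX X Z | z.1 + z.2 == w].
have hP w : w \in sumset X Z -> [/\ (h w).1 \in X, (h w).2 \in Z &
    (h w).1 + (h w).2 = w].
  move=> /sumsetP[x [z [xX zZ ->]]]; rewrite /h; case: pickP => [[a b]|].
    by rewrite !inE /= => /andP[/andP[-> ->] /eqP ->].
  by move/(_ (x, z)); rewrite !inE /= xX zZ eqxx.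
pose f (t : F * F) := ((h t.1).1 + t.2, - t.2 + (h t.1).2).
rewrite -!cardsX -(@card_in_imset _ _ f (setX (sumset X Z) Y)).
  apply: subset_leq_card; apply/subsetP => _ /imsetP[[w y] /setXP[wXZ yY] ->].
  have [h1 h2 h3] := hP w wXZ; rewrite !inE /= !mem_sumset //.
  by apply: imset_f.
move=> [w y] [w' y'] /setXP[/= /hP[h1 h2 h3] yY] /setXP[/= /hP[k1 k2 k3] yY'].
case=> /= e1 e2.
have ww' : w = w'.
  rewrite -h3 -k3; have := congr1 (+%R ((h w).1 + y)) e2.
  by rewrite {2}e1 !addrA !addrK.
by move: e1; rewrite ww' => /addrI ->.
Qed.

(* Petridis's form of Pluennecke's inequality: a subset of [X] minimising the
   expansion ratio [#|X' + B| / #|X'|] keeps that ratio after adding any [C]. *)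
Lemma petridis X B : X != set0 ->
  exists X', [/\ X' \subset X, X' != set0,
    (#|sumset X' B| * #|X| <= #|sumset X B| * #|X'|)%N &
    forall C, (#|sumset (sumset X' B) C| * #|X'|
      <= #|sumset X' B| * #|sumset X' C|)%N].
Proof.
move=> X0.
pose r Z : rat := #|sumset Z B|%:R / #|Z|%:R.
have PX : (X \subset X) && (X != set0) by rewrite subxx.
case: (@Order.TotalTheory.arg_minP _ _ _ X
  (fun Z => (Z \subset X) && (Z != set0)) r PX) => X' /andP[X'X X'0] minr.
have X'gt : (0 < #|X'|)%N by rewrite card_gt0.
have minX Z : Z \subset X -> (#|sumset X' B| * #|Z| <= #|sumset Z B| * #|X'|)%N.
  case: (eqVneq Z set0) => [-> _|Z0 ZX]; first by rewrite cards0 muln0.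
  have := minr Z; rewrite ZX Z0 => /(_ isT); rewrite /r.
  rewrite ler_pdivrMr ?ltr0n // mulrAC ler_pdivlMr ?ltr0n ?card_gt0 //.
  by rewrite -!natrM ler_nat.
exists X'; split=> //; first by apply: minX.
move=> C; move: {2}#|C| (leqnn #|C|) => n; elim: n C => [|n IHn] C.
  rewrite leqn0 cards_eq0 => /eqP ->.
  suff -> : sumset (sumset X' B) set0 = set0 by rewrite cards0.
  by apply/setP => x; rewrite inE; apply/negP => /sumsetP[a [b []]]; rewrite inE.
case: (set_0Vmem C) => [-> _|[c cC] Cn].
  by apply: IHn; rewrite cards0.
have /IHn {}IHn : (#|C :\ c| <= n)%N by move: Cn; rewrite (cardsD1 c) cC.
set C' := C :\ c in IHn.
have CE : C = c |: C' by rewrite setD1K.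
set P := sumset (sumset X' B) C' in IHn.
(* Induction on [C], removing [c]. For [x] in [Z] all of [x + B + c] lies in [P] already, so [c]
   adds at most [#|X' + B| - #|Z + B|] elements to [P]. It adds at least [#|X'| - #|W|] elements to
   [X' + C']. Minimality for [Z] and the inclusion of [W] in [Z] compare the two. *)
pose Z := [set x in X' | [forall b in B, x + b + c \in P]].
pose W := [set x in X' | x + c \in sumset X' C'].
have ZX' : Z \subset X' by apply/subsetP => x; rewrite inE => /andP[].
have WZ : W \subset Z.
  apply/subsetP => x; rewrite !inE => /andP[-> /sumsetP[a [d [aX dC e]]]] /=.
  apply/forall_inP => b bB; rewrite addrAC e addrAC.
  by rewrite !mem_sumset.
have WX' : W \subset X' by apply: subset_trans WZ ZX'.
have up : (#|sumset (sumset X' B) C| + #|sumset Z B| <= #|P| + #|sumset X' B|)%N.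
  have ZB : sumset Z B \subset sumset X' B by apply: sumsetS.
  rewrite -(cardsID (sumset Z B) (sumset X' B)) (setIidPr ZB).
  rewrite addnCA [X in (X <= _)%N]addnC leq_add2l.
  rewrite -(card_sumset1 (_ :\: _) c).
  apply: (@leq_trans #|P :|: sumset (sumset X' B :\: sumset Z B) [set c]|).
    apply: subset_leq_card; apply/subsetP => _ /sumsetP[y [d [yXB dC ->]]].
    move: dC; rewrite CE => /setU1P[->|dC']; last by rewrite inE mem_sumset.
    rewrite inE; case: (boolP (y \in sumset Z B)) => [|yZ].
      move=> /sumsetP[z [b [zZ bB ->]]]; apply/orP; left.
      by move: zZ; rewrite inE => /andP[_ /forall_inP]; apply.
    by apply/orP; right; rewrite mem_sumset ?set11 // inE yZ.
  by rewrite cardsU addnC leq_subr.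
have lo : (#|sumset X' C'| + #|X'| <= #|sumset X' C| + #|W|)%N.
  rewrite -(cardsID W X') (setIidPr WX') addnCA [X in (X <= _)%N]addnC leq_add2r.
  rewrite -(card_sumset1 (_ :\: _) c) -cardsUI.
  suff -> : sumset X' C' :&: sumset (X' :\: W) [set c] = set0.
    rewrite cards0 addn0; apply: subset_leq_card; rewrite subUset; apply/andP.
    split; first by rewrite sumsetS // CE subsetUr.
    by rewrite sumsetS ?subsetDl // CE subsetUl.
  apply/setP => x; rewrite in_set0; apply/negP => /setIP[xC].
  case/sumsetP => a [d [/setDP[aX /negP aW] /set1P -> e]].
  by apply: aW; rewrite inE aX -e.
have := minX Z (subset_trans ZX' X'X).
have := subset_leq_card WZ.
move: up lo IHn.
move: (#|sumset _ C|) (#|sumset Z B|) (#|P|) (#|sumset X' B|) (#|sumset X' C'|)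
  (#|X'|) (#|sumset X' C|) (#|W|) (#|Z|) => a b c0 d e f g h i; nia.
Qed.

End Sumset.

Lemma card_collisions (S T : finType) (A : {set S}) (D : {set T}) (f : S -> T) :
  {in A, forall a, f a \in D} ->
  #|A| ^ 2 <= #|D| * #|[set z in setX A A | f z.1 == f z.2]|.
Proof.
move=> fAD; pose r z := #|[set a in A | f a == z]|.
have -> : #|A| = \sum_(z in D) r z.
  rewrite -sum1_card (partition_big f (mem D)) //=.
  by apply: eq_bigr => z _; rewrite sum1dep_card.
apply: leq_trans (cauchy_schwarz_nat _ _) _; rewrite leq_mul2l; apply/orP; right.
rewrite -[X in _ <= X]sum1_card.
rewrite (partition_big (fun z : S * S => f z.1) (mem D)) /=; last first.
  by case=> a b; rewrite !inE /= => /andP[/andP[/fAD]].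
apply: leq_sum => z _; rewrite sum1dep_card -mulnn /r -cardsX.
apply: subset_leq_card; apply/subsetP => -[a b]; rewrite !inE /=.
by case/andP => /andP[-> /eqP ->] /andP[-> /eqP ->]; rewrite !eqxx.
Qed.

(** * Sets [a U + b V] and the multipliers [c] for which [U - c U] is small *)

Section Comb.
Variable F : finFieldType.
Implicit Types (A B U V W X : {set F}) (a b c s t : F).
Local Open Scope ring_scope.

Lemma dilateM a b A : dilate a (dilate b A) = dilate (a * b) A.
Proof. by rewrite /dilate -imset_comp; apply: eq_imset => x /=; rewrite mulrA. Qed.

Lemma dilate1 A : dilate 1 A = A.
Proof. by rewrite -[RHS]imset_id; apply: eq_imset => x; rewrite mul1r. Qed.

Lemma card_dilate a A : a != 0 -> #|dilate a A| = #|A|.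
Proof. by move=> a0; rewrite card_imset //; apply: mulfI. Qed.

Lemma dilate_sumset t A B :
  dilate t (sumset A B) = sumset (dilate t A) (dilate t B).
Proof.
apply/setP => x; apply/imsetP/sumsetP.
  case=> _ /sumsetP[a [b [aA bB ->]]] ->; exists (t * a), (t * b).
  by rewrite !imset_f // mulrDr.
case=> _ [_ [/imsetP[a aA ->] /imsetP[b bB ->] ->]]; exists (a + b).
  exact: mem_sumset.
by rewrite mulrDr.
Qed.

Lemma opp_dilate b V : -%R @: dilate b V = dilate (- b) V.
Proof. by rewrite /dilate -imset_comp; apply: eq_imset => x /=; rewrite mulNr. Qed.

Lemma combC a U b V : comb a U b V = comb b V a U.
Proof. exact: sumsetC. Qed.

Lemma mem_comb a U b V u v :
  u \in U -> v \in V -> a * u + b * v \in comb a U b V.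
Proof. by move=> uU vV; rewrite mem_sumset // imset_f. Qed.

Lemma combP a U b V x :
  reflect (exists u v, [/\ u \in U, v \in V & x = a * u + b * v])
    (x \in comb a U b V).
Proof.
apply: (iffP (sumsetP _ _ _)).
  by case=> _ [_ [/imsetP[u uU ->] /imsetP[v vV ->] ->]]; exists u, v.
by case=> u [v [uU vV ->]]; exists (a * u), (b * v); rewrite !imset_f.
Qed.

Lemma combS a U U' b V V' :
  U \subset U' -> V \subset V' -> comb a U b V \subset comb a U' b V'.
Proof. by move=> sU sV; apply: sumsetS; apply: imsetS. Qed.

Lemma card_comb_scale t a U b V :
  t != 0 -> #|comb (t * a) U (t * b) V| = #|comb a U b V|.
Proof. by move=> t0; rewrite /comb -!dilateM -dilate_sumset card_dilate. Qed.

Lemma card_comb_opp a U b V : #|comb (- a) U b V| = #|comb a U (- b) V|.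
Proof.
rewrite -(@card_comb_scale (-1) a U) ?oppr_eq0 ?oner_eq0 //.
by rewrite !mulN1r opprK.
Qed.

Lemma ruzsa_comb a U b V c W : b != 0 ->
  (#|comb a U c W| * #|V| <= #|comb a U b V| * #|comb b V (- c) W|)%N.
Proof.
move=> b0; rewrite -card_comb_opp -[#|V|](card_dilate _ b0).
by apply: leq_trans (ruzsa_triangle _ (dilate b V) _) _; rewrite opp_dilate.
Qed.

Definition small_diff (H : nat) U c := (#|comb 1 U (- c) U| <= H * #|U|)%N.

Arguments small_diff H%_nat_scope U c%_ring_scope.

Lemma small_diff_weaken H H' U c : (H <= H')%N -> small_diff H U c -> small_diff H' U c.
Proof. by move=> HH' /leq_trans; apply; rewrite leq_mul2r HH' orbT. Qed.

Lemma small_diff_inv H U c : c != 0 -> small_diff H U c -> small_diff H U c^-1.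
Proof.
move=> c0; rewrite /small_diff => /(leq_trans _); apply.
by rewrite -(@card_comb_scale c 1 U (- c^-1) U c0) mulr1 mulrN mulfV //
  combC card_comb_opp.
Qed.

(** Ruzsa's triangle inequality through [s U]: the set [s U - s t U] is a dilate of [U - t U]. *)
Lemma small_diff_mul H L U s t : (0 < H)%N -> (0 < L)%N -> U != set0 ->
  small_diff H U s -> small_diff L U t -> small_diff (H * L) U (s * t).
Proof.
rewrite -card_gt0 => H0 L0 U0; case: (eqVneq s 0) => [->|s0] gs gt.
  rewrite mul0r /small_diff oppr0; apply: (@leq_trans #|U|); last first.
    by rewrite leq_pmull // muln_gt0 H0.
  apply: subset_leq_card; apply/subsetP => x /combP[u [v [uU _ ->]]].
  by rewrite mul1r mul0r addr0.
have := @ruzsa_comb 1 U (- s) U (- (s * t)) U; rewrite oppr_eq0 => /(_ s0).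
rewrite opprK card_comb_opp.
have -> : #|comb s U (- (s * t)) U| = #|comb 1 U (- t) U|.
  by rewrite -(@card_comb_scale s 1 U (- t)) // mulr1 mulrN.
move=> h.
rewrite /small_diff -(leq_pmul2r U0); apply: (leq_trans h).
by apply: leq_trans (leq_mul gs gt) _; apply: eq_leq; ring.
Qed.

Lemma small_diff_one H U s : s != 0 -> U != set0 -> small_diff H U s -> small_diff (H ^ 2) U 1.
Proof.
move=> s0 U0 gs.
have H0 : (0 < H)%N.
  case: H gs => //; rewrite /small_diff mul0n leqn0 cards_eq0.
  case/set0Pn: U0 => u uU /eqP e.
  by have := mem_comb 1 (- s) uU uU; rewrite e inE.
by rewrite -(mulfV s0) -mulnn; apply: small_diff_mul => //; apply: small_diff_inv.
Qed.

(** This passes from [U - U] to [U + U]. Petridis's inequality with [B = - U] gives [X'] with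
    [#|X' - U - U| <= H ^ 2 * #|X'|], and [X' - U - U] contains a translate of [- (U + U)]. *)
Lemma small_diff_opp1 H U : U != set0 -> small_diff H U 1 -> small_diff (H ^ 2) U (-1).
Proof.
move=> U0 g1; have Ugt : (0 < #|U|)%N by rewrite card_gt0.
have [X' [X'U X'0 h1 h2]] := petridis (dilate (-1) U) U0.
have X'gt : (0 < #|X'|)%N by rewrite card_gt0.
have e1 : (#|sumset X' (dilate (-1) U)| <= H * #|X'|)%N.
  rewrite -(leq_pmul2r Ugt); apply: (leq_trans h1).
  by rewrite mulnAC leq_mul2r; move: g1; rewrite /small_diff /comb dilate1 => ->; rewrite orbT.
have := h2 (dilate (-1) U); set D := dilate (-1) U in e1 *.
case/set0Pn: X'0 => x xX' h3.
have e2 : (#|comb 1 U (- -1) U| <= #|sumset (sumset X' D) D|)%N.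
  rewrite -card_comb_opp -(card_sumset1 (comb _ _ _ _) x); apply: subset_leq_card.
  apply/subsetP => _ /sumsetP[y [_ [/combP[u [v [uU vU ->]]] /set1P -> ->]]].
  by rewrite addrC addrA !mem_sumset // imset_f.
rewrite /small_diff; apply: (leq_trans e2).
move: e1 h3 (subset_leq_card X'U) X'gt.
move: (#|sumset X' D|) (#|sumset (sumset X' D) D|) (#|X'|) (#|U|) => a b d u.
move=> ad h3 du d0; apply: (@leq_trans (H ^ 2 * d)); last by rewrite leq_mul.
rewrite -(leq_pmul2r d0); apply: (leq_trans h3).
by apply: leq_trans (leq_mul ad ad) _; apply: eq_leq; ring.
Qed.

(** Let [B] be the union of [- s U], [- t U] and [U], so that [#|U + B| <= 3 H #|U|]; the multiplier
    [-1] serves the part [U + U]. Petridis's inequality bounds [X' + B + B + B], which contains a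
    translate of [U - (s + t) U]. *)
Lemma small_diff_add H U s t : U != set0 ->
  small_diff H U s -> small_diff H U t -> small_diff H U (-1) -> small_diff (27 * H ^ 3) U (s + t).
Proof.
move=> U0 gs gt g1; have Ugt : (0 < #|U|)%N by rewrite card_gt0.
pose B := dilate (- s) U :|: dilate (- t) U :|: U.
have UB : (#|sumset U B| <= 3 * H * #|U|)%N.
  apply: (@leq_trans #|comb 1 U (- s) U :|: comb 1 U (- t) U
    :|: comb 1 U (- -1) U|).
    apply: subset_leq_card; apply/subsetP => _ /sumsetP[u [b [uU bB ->]]].
    rewrite /comb opprK !dilate1.
    by move: bB; rewrite !inE => /orP[/orP[]|] h; rewrite (mem_sumset uU h) ?orbT.
  apply: leq_trans (leq_card_setU _ _) _.
  apply: (@leq_trans (H * #|U| + H * #|U| + H * #|U|)); last by apply: eq_leq; ring.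
  by apply: leq_add => //; apply: leq_trans (leq_card_setU _ _) _; apply: leq_add.
have [X' [X'U X'0 h1 h2]] := petridis B U0.
have X'gt : (0 < #|X'|)%N by rewrite card_gt0.
have e1 : (#|sumset X' B| <= 3 * H * #|X'|)%N.
  rewrite -(leq_pmul2r Ugt); apply: (leq_trans h1).
  by rewrite mulnAC leq_mul2r UB orbT.
have e2 : (#|sumset X' (sumset B B)| <= (3 * H) ^ 2 * #|X'|)%N.
  rewrite -(leq_pmul2r X'gt) sumsetA; apply: (leq_trans (h2 B)).
  by apply: leq_trans (leq_mul e1 e1) _; apply: eq_leq; ring.
have e3 : (#|sumset (sumset X' B) (sumset B B)| <= (3 * H) ^ 3 * #|X'|)%N.
  rewrite -(leq_pmul2r X'gt); apply: (leq_trans (h2 (sumset B B))).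
  by apply: leq_trans (leq_mul e1 e2) _; apply: eq_leq; ring.
case/set0Pn: X'0 => x xX'.
have e4 : (#|comb 1 U (- (s + t)) U| <= #|sumset (sumset X' B) (sumset B B)|)%N.
  rewrite -(card_sumset1 (comb _ _ _ _) x); apply: subset_leq_card.
  apply/subsetP => _ /sumsetP[y [_ [/combP[u [v [uU vU ->]]] /set1P -> ->]]].
  have -> : 1 * u + - (s + t) * v + x = x + u + (- s * v + - t * v) by ring.
  by rewrite !mem_sumset // !inE ?uU ?imset_f ?orbT.
rewrite /small_diff; apply: (leq_trans e4); apply: (leq_trans e3).
by rewrite expnMn leq_mul // subset_leq_card.
Qed.

(** Count the solutions of [u1 - c u2 = u3 - c u4] in two ways. By Cauchy-Schwarz each [c] in [R]
    has at least [#|U| ^ 3 / H] of them; a quadruple with [(u1, u2) != (u3, u4)] admits at most one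
    [c], and the others admit all of [R]. *)
Lemma small_diff_energy H U (R : {set F}) : U != set0 ->
  {in R, forall c, small_diff H U c} ->
  (#|R| * #|U| <= H * (#|U| ^ 2 + #|R|))%N.
Proof.
rewrite -card_gt0 => U0 gR.
pose Q := setX (setX U U) (setX U U).
pose hit (c : F) (z : (F * F) * (F * F)) :=
  z.1.1 + - c * z.1.2 == z.2.1 + - c * z.2.2.
have E c : c \in R -> (#|U| ^ 3 <= H * #|[set z in Q | hit c z]|)%N.
  move=> /gR gc.
  have hD : {in setX U U, forall z, z.1 + - c * z.2 \in comb 1 U (- c) U}.
    by case=> a b /setXP[/= aU bU]; rewrite -[a in a + _]mul1r mem_comb.
  have := card_collisions hD.
  rewrite cardsX -/Q => h; rewrite -(leq_pmul2r U0).
  apply: (@leq_trans ((#|U| * #|U|) ^ 2)); first by apply: eq_leq; ring.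
  apply: (leq_trans h); rewrite mulnAC leq_mul2r; apply/orP; right.
  exact: gc.
have up : (\sum_(c in R) #|[set z in Q | hit c z]| <= #|U| ^ 4 + #|R| * #|U| ^ 2)%N.
  rewrite sum_card_exchange.
  pose diag := [set z in Q | z.1 == z.2].
  have diagU : #|diag| = (#|U| ^ 2)%N.
    rewrite -mulnn -cardsX -[RHS](@card_imset _ _ (fun x => (x, x))); last first.
      by move=> x y [].
    congr #|pred_of_set _|; apply/setP => -[z1 z2]; rewrite inE.
    apply/andP/imsetP; first by case=> /setXP[/= h _] /eqP /= <-; exists z1.
    by case=> x xU [-> ->]; rewrite !inE /= in xU *; rewrite xU eqxx.
  have diagQ : diag \subset Q by apply/subsetP => z; rewrite inE => /andP[].
  have QU : #|Q| = (#|U| ^ 4)%N by rewrite !cardsX; ring.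
  rewrite (big_setID diag) /= (setIidPr diagQ) addnC; apply: leq_add.
    apply: (@leq_trans (\sum_(z in Q :\: diag) 1)); last first.
      by rewrite sum1_card -QU subset_leq_card // subsetDl.
    apply: leq_sum => -[[u1 u2] [u3 u4]] /setDP[zQ zd].
    have u24 : [set c in R | hit c ((u1, u2), (u3, u4))] != set0 -> u2 != u4.
      case/set0Pn => c; rewrite inE /hit /= => /andP[_ /eqP e].
      apply: contra zd => /eqP e2; rewrite inE zQ /=.
      by move: e; rewrite -e2 => /addIr ->.
    case: (eqVneq [set c in R | hit c ((u1, u2), (u3, u4))] set0) => [->|n0].
      by rewrite cards0.
    have {}u24 := u24 n0.
    rewrite -(cards1 ((u1 - u3) / (u2 - u4))); apply: subset_leq_card.
    apply/subsetP => c; rewrite !inE /hit /= => /andP[_ /eqP e].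
    have d0 : u2 - u4 != 0 by rewrite subr_eq0.
    apply/eqP; apply: (mulIf d0); rewrite mulfVK //.
    rewrite mulrBr; apply/eqP; rewrite eq_sym subr_eq addrAC eq_sym subr_eq.
    apply/eqP.
    have -> : u1 = u3 + - c * u4 + c * u2 by rewrite -e; ring.
    ring.
  rewrite -diagU mulnC -sum_nat_const; apply: leq_sum => z _.
  by apply: subset_leq_card; apply/subsetP => c; rewrite inE => /andP[].
have lo : (#|R| * #|U| ^ 3 <= H * \sum_(c in R) #|[set z in Q | hit c z]|)%N.
  by rewrite -sum_nat_const big_distrr /=; apply: leq_sum.
have U2 : (0 < #|U| ^ 2)%N by rewrite expn_gt0 U0.
rewrite -(leq_pmul2r U2).
apply: (@leq_trans (#|R| * #|U| ^ 3)); first by apply: eq_leq; ring.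
apply: (leq_trans lo).
apply: (@leq_trans (H * (#|U| ^ 4 + #|R| * #|U| ^ 2))).
  by rewrite leq_mul2l up orbT.
by apply: eq_leq; ring.
Qed.

End Comb.

Arguments small_diff {F} H%_nat_scope U c%_ring_scope.

(** * Dilations with small difference sets in a prime field *)

Section Pivot.
Local Open Scope ring_scope.

(* [q = (s1 - s2) / (s3 - s4)] is a quotient of differences; a prime field has
   no proper nonempty subset stable under [+1], so either all of ['F_p] consists
   of such quotients, or some [q + 1] is not one and then
   [(s, s') |-> s + (q + 1) s'] is injective on [S * S]. *)
Lemma pivot (p : nat) (S : {set 'F_p}) : prime p -> (1 < #|S|)%N ->
  exists2 R : {set 'F_p}, (minn (#|S| ^ 2) p <= #|R|)%N &
    {in R, forall c, exists s1 s2 s3 s4 s5 s6,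
      [/\ [/\ s1 \in S, s2 \in S, s3 \in S & s4 \in S],
          s5 \in S, s6 \in S, s3 != s4 &
        c = (s1 - s2) / (s3 - s4) \/
        c = s5 + ((s1 - s2) / (s3 - s4) + 1) * s6]}.
Proof.
move=> p_pr S1.
pose Q : {set 'F_p} := [set x | [exists s : ('F_p * 'F_p) * ('F_p * 'F_p),
  [&& s.1.1 \in S, s.1.2 \in S, s.2.1 \in S, s.2.2 \in S, s.2.1 != s.2.2 &
  x == (s.1.1 - s.1.2) / (s.2.1 - s.2.2)]]].
have QP x : reflect (exists s1 s2 s3 s4, [/\ [/\ s1 \in S, s2 \in S, s3 \in S &
    s4 \in S], s3 != s4 & x = (s1 - s2) / (s3 - s4)]) (x \in Q).
  rewrite inE; apply: (iffP existsP).
    case=> -[[s1 s2] [s3 s4]] /=.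
    by case/and5P => h1 h2 h3 h4 /andP[h5 /eqP h6]; exists s1, s2, s3, s4.
  case=> s1 [s2 [s3 [s4 [[h1 h2 h3 h4] h5 h6]]]].
  by exists ((s1, s2), (s3, s4)); rewrite /= h1 h2 h3 h4 h5 h6 eqxx.
have [a [b [aS bS ab]]] : exists a b, [/\ a \in S, b \in S & a != b].
  by case/card_gt1P: S1 => a [b []]; exists a, b.
have Q0 : 0 \in Q.
  by apply/QP; exists a, a, a, b; rewrite subrr mul0r.
case: (boolP [forall x in Q, x + 1 \in Q]) => [/forall_inP stable|].
  have QT : Q = setT.
    have nQ n : n%:R \in Q.
      by elim: n => [//|n IH]; rewrite -addn1 natrD stable.
    by apply/setP => x; rewrite [RHS]inE -(natr_Zp x) nQ.
  exists Q; first by rewrite QT cardsT card_Fp // geq_minr.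
  by move=> c /QP[s1 [s2 [s3 [s4 [h1 h2 h3]]]]]; exists s1, s2, s3, s4, a, a;
    split=> //; left.
rewrite negb_forall_in => /exists_inP[q qQ q1].
exists [set z.1 + (q + 1) * z.2 | z in setX S S].
  rewrite card_in_imset ?cardsX ?mulnn ?geq_minl // => -[x y] [x' y'].
  case/setXP => /= xS yS /setXP[/= x'S y'S] e.
  case: (eqVneq y y') e => [-> /addIr -> //|yy' e].
  case/negP: q1; apply/QP; exists x, x', y', y; split=> //; first by rewrite eq_sym.
  have d0 : y' - y != 0 by rewrite subr_eq0 eq_sym.
  apply: (mulIf d0); rewrite mulfVK // mulrBr.
  have -> : x = x' + (q + 1) * y' - (q + 1) * y by rewrite -e; ring.
  ring.
move=> _ /imsetP[[s5 s6] /setXP[/= h5 h6] ->].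
case/QP: qQ => s1 [s2 [s3 [s4 [h1 h2 h3]]]].
by exists s1, s2, s3, s4, s5, s6; split=> //; right; rewrite -h3.
Qed.

End Pivot.

(** Every element of the set [R] from [pivot] is made from [S] and [1] by boundedly many field
    operations, so it is a multiplier with constant a power of [K]. The energy bound then limits
    [#|R|]. *)
Lemma small_diff_multipliers : exists e : nat, forall (p K : nat) (U S : {set 'F_p}),
  prime p -> 1 < K -> U != set0 -> 1 < #|S| -> {in S, forall s, small_diff K U s} ->
  #|U| <= K ^ e \/ minn (#|S| ^ 2) p <= K ^ e * #|U|.
Proof.
(* Exponents of [K]: a product adds them and a sum multiplies them by 8. A difference of elements of
   [S] costs [8 * 5], where 5 comes from [-1] and one element of [S]. The two conditions are the
   costs of the two forms of [c] in [pivot]. *)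
have [e e1 e2] : exists2 e, 8 * 5 + 8 * 5 <= e &
    8 * (8 * (8 * 5 + 8 * 5) + 1) <= e.
  by exists (8 * (8 * (8 * 5 + 8 * 5) + 1)); lia.
exists e.+1 => p K U S p_pr K1 U0 S1 gS.
have K0 : 0 < K by apply: ltnW.
have Kn n : 0 < K ^ n by rewrite expn_gt0 K0.
have G_mono m n c : m <= n -> small_diff (K ^ m) U c -> small_diff (K ^ n) U c.
  by move=> mn; apply: small_diff_weaken; rewrite leq_exp2l.
have G_mul m n s t : small_diff (K ^ m) U s -> small_diff (K ^ n) U t ->
    small_diff (K ^ (m + n)) U (s * t)%R.
  by rewrite expnD; apply: small_diff_mul.
have GS s : s \in S -> small_diff (K ^ 1) U s by rewrite expn1; apply: gS.
have [s0 s0S s00] : exists2 s, s \in S & s != 0%R.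
  case/card_gt1P: S1 => a [b [aS bS ab]]; case: (eqVneq a 0%R) ab => [->|a0] ab.
    by exists b; rewrite // eq_sym.
  by exists a.
have G1 : small_diff (K ^ 2) U 1 by apply: (small_diff_one s00) => //; apply: gS.
have GN1 : small_diff (K ^ 4) U (-1) by rewrite (expnM K 2 2); apply: small_diff_opp1.
have G_add n s t : 4 <= n -> small_diff (K ^ n) U s -> small_diff (K ^ n) U t ->
    small_diff (K ^ (8 * n)) U (s + t)%R.
  move=> n4 gs gt; apply: (small_diff_weaken _ (small_diff_add U0 gs gt (G_mono _ _ _ n4 GN1))).
  rewrite (_ : 8 * n = 5 * n + n * 3); last by ring.
  rewrite expnD (expnM _ n) leq_mul2r; apply/orP; right.
  apply: (@leq_trans (K ^ 5)); last by rewrite leq_exp2l //; lia.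
  by apply: (@leq_trans (2 ^ 5)) => //; rewrite leq_exp2r.
have GB s t : s \in S -> t \in S -> small_diff (K ^ (8 * 5)) U (s - t)%R.
  move=> sS tS; apply: G_add; first exact: isT.
    exact: G_mono (GS s sS).
  by rewrite -mulN1r; apply: (G_mul 4 1) GN1 (GS t tS).
have [R Rbig RP] := pivot p_pr S1.
have GR : {in R, forall c, small_diff (K ^ e) U c}.
  move=> c /RP[s1 [s2 [s3 [s4 [s5 [s6 [[h1 h2 h3 h4] h5 h6 s34]]]]]]].
  have Gq : small_diff (K ^ (8 * 5 + 8 * 5)) U ((s1 - s2) / (s3 - s4))%R.
    apply: G_mul (GB _ _ h1 h2) (small_diff_inv _ (GB _ _ h3 h4)).
    by rewrite subr_eq0.
  case=> ->; first exact: G_mono e1 Gq.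
  apply: (G_mono _ _ _ e2).
  have q4 : 4 <= 8 * 5 + 8 * 5 by [].
  have q4' : 1 <= 8 * (8 * 5 + 8 * 5) + 1 by rewrite addn1.
  have q4'' : 4 <= 8 * (8 * 5 + 8 * 5) + 1 by rewrite addn1.
  have q2 : 2 <= 8 * 5 + 8 * 5 by [].
  apply: (G_add _ _ _ q4'' (G_mono _ _ _ q4' (GS _ h5))).
  exact: G_mul (G_add _ _ _ q4 Gq (G_mono _ _ _ q2 G1)) (GS _ h6).
have := small_diff_energy U0 GR; set r := #|R|; set u := #|U| => en.
(* If [u] exceeds [K ^ e.+1 >= 2 * K ^ e], the term [K ^ e * r] of the energy bound is at most half
   of its left side, and [r <= 2 * K ^ e * u] remains. *)
have [small|big] := leqP u (K ^ e.+1); [by left|right].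
apply: (leq_trans Rbig); rewrite -/r.
have u0 : 0 < u by apply: leq_ltn_trans big.
rewrite -(leq_pmul2r u0).
have Ke : 2 * K ^ e <= K ^ e.+1 by rewrite expnS leq_mul2r K1 orbT.
move: en Ke (ltnW big); move: (K ^ e) (K ^ e.+1) => a b en ab bu.
have h1 : 2 * a * r <= b * r by rewrite leq_mul2r ab orbT.
have h2 : b * r <= u * r by rewrite leq_mul2r bu orbT.
have h3 : 2 * a * u ^ 2 <= b * u ^ 2 by rewrite leq_mul2r ab orbT.
have -> : b * u * u = b * u ^ 2 by ring.
nia.
Qed.

(** * From affine relations to small difference sets *)

(** Cauchy-Schwarz for the number of sets [S i] through each point of [D] bounds the sum of all
    [#|S i :&: S j|] from below; [j] is the best index in that double sum. *)
Lemma popular_intersection (T T' : finType) (L : {set T}) (S : T -> {set T'})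
    (D : {set T'}) :
  0 < #|L| -> {in L, forall i, S i \subset D} ->
  exists2 j, j \in L &
    (\sum_(i in L) #|S i|) ^ 2 <= #|D| * (#|L| * \sum_(i in L) #|S i :&: S j|).
Proof.
move=> L0 SD; pose d z := #|[set i in L | z \in S i]|.
have ES : \sum_(i in L) #|S i| = \sum_(z in D) d z.
  rewrite -(sum_card_exchange L D (fun i z => z \in S i)).
  apply: eq_bigr => i /SD iD; congr #|pred_of_set _|.
  by apply/setP => z; rewrite inE; case: (boolP (z \in S i)) => [/(subsetP iD) ->|];
    rewrite ?andbF.
have Ed : \sum_(z in D) d z ^ 2 = \sum_(j in L) \sum_(i in L) #|S i :&: S j|.
  transitivity (\sum_(z in D) #|[set q in setX L L | (z \in S q.1) && (z \in S q.2)]|).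
    apply: eq_bigr => z _; rewrite -mulnn /d -cardsX; congr #|pred_of_set _|.
    by apply/setP => -[i j]; rewrite !inE /= andbACA.
  rewrite (sum_card_exchange D (setX L L) (fun z q => (z \in S q.1) && (z \in S q.2))).
  rewrite exchange_big /= pair_big /=; apply: eq_big => [[i j]|[i j] /setXP[/= iL jL]].
    by rewrite inE.
  congr #|pred_of_set _|; apply/setP => z; rewrite !inE.
  by case: (boolP (z \in S i)) => [/(subsetP (SD _ iL)) ->|]; rewrite ?andbF.
have [j jL jP] := sum_exists_le (fun j => \sum_(i in L) #|S i :&: S j|) L0.
exists j => //; rewrite ES; apply: leq_trans (cauchy_schwarz_nat _ _) _.
by rewrite leq_mul2l Ed jP orbT.
Qed.

(* Balog-Szemeredi-Gowers: each value [l u + (1 - l) v] is, once per path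
   [u - y1 - x1 - v], an alternating sum of three elements of [Y]. *)
Lemma bsg_comb (F : finFieldType) (l : F) (Y : {set F}) (N K : nat) :
  l != 0%R -> l != 1%R -> 0 < N -> #|Y| <= N ->
  N ^ 2 <= K * #|[set z in setX Y Y | (l * z.1 + (1 - l) * z.2)%R \in Y]| ->
  exists UV : {set F} * {set F}, [/\ UV.1 \subset Y, UV.2 \subset Y,
    N <= 6 * K * #|UV.1|, N <= 4 * K * #|UV.2| &
    #|comb l UV.1 (1 - l) UV.2| <= 48 * 512 * K ^ 5 * N].
Proof.
move=> l0 l1 N0 YN dense.
pose e (x y : F) := (l * x + (1 - l) * y)%R \in Y.
have {}dense : N ^ 2 <= K * \sum_(x in Y) #|[set y in Y | e x y]|.
  apply: (leq_trans dense); rewrite leq_mul2l; apply/orP; right.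
  rewrite -(card_dep_pair Y (fun x => [set y in Y | e x y])).
  by apply/eq_leq/eq_card => -[x y]; rewrite !inE /= andbA.
have [U [V [UY VY NU NV paths]]] := bsg_paths N0 YN YN dense.
exists (U, V); split=> //=; set M := 48 * 512 * K ^ 5.
pose h v := odflt (0, 0)%R [pick z in setX U V | (l * z.1 + (1 - l) * z.2)%R == v].
have hP v : v \in comb l U (1 - l) V ->
    [/\ (h v).1 \in U, (h v).2 \in V & (l * (h v).1 + (1 - l) * (h v).2 = v)%R].
  move=> /combP[x [y [xU yV ->]]]; rewrite /h; case: pickP => [[a b]|].
    by rewrite !inE /= => /andP[/andP[-> ->] /eqP ->].
  by move/(_ (x, y)); rewrite !inE /= xU yV eqxx.
pose P v := [set z : F * F | [&& z.1 \in Y, z.2 \in Y, e (h v).1 z.2,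
  e z.1 z.2 & e z.1 (h v).2]].
have up : \sum_(v in comb l U (1 - l) V) #|P v| <= N ^ 3.
  apply: (@leq_trans #|setX (setX Y Y) Y|); last first.
    rewrite !cardsX (_ : N ^ 3 = N * N * N); last by ring.
    by rewrite !leq_mul.
  rewrite -card_dep_pair.
  (* The first coordinate minus the second plus the third is [v]. The fixed representation of [v]
     then gives [y1], because [1 - l] is nonzero, and [x1], because [l] is nonzero. *)
  pose f (t : F * (F * F)) := ((l * (h t.1).1 + (1 - l) * t.2.2,
    l * t.2.1 + (1 - l) * t.2.2), l * t.2.1 + (1 - l) * (h t.1).2)%R.
  rewrite -(@card_in_imset _ _ f); last first.
    move=> [v [x1 y1]] [v' [x1' y1']]; rewrite inE /= => /andP[/hP[a1 a2 a3] _].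
    rewrite inE /= => /andP[/hP[b1 b2 b3] _] [] e1 e2 e3.
    have vv' : v = v'.
      rewrite -a3 -b3.
      have := congr2 (fun x y => x + y)%R e1 e3; have := congr1 -%R%R e2.
      move=> /(congr2 (fun x y => x + y)%R) /[apply] {e1 e2 e3}.
      set A := (X in X = _ -> _); set B := (X in _ = X -> _) => AB.
      transitivity A; first by rewrite /A; ring.
      by rewrite AB /B; ring.
    move: e1; rewrite vv' => /addrI /(mulfI _) y11.
    have {}y11 : y1 = y1' by apply: y11; rewrite subr_eq0 eq_sym.
    by move: e2; rewrite y11 => /addIr /(mulfI l0) ->.
  apply: subset_leq_card; apply/subsetP => _ /imsetP[[v [x1 y1]] + ->].
  rewrite !inE /= => /andP[_ /and5P[_ _]].
  by rewrite /e => -> -> ->.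
have lo : #|comb l U (1 - l) V| * N ^ 2 <= M * \sum_(v in comb l U (1 - l) V) #|P v|.
  rewrite -sum_nat_const big_distrr /=; apply: leq_sum => v /hP[h1 h2 _].
  exact: paths.
have N2 : 0 < N ^ 2 by rewrite expn_gt0 N0.
rewrite -(leq_pmul2r N2); apply: (leq_trans lo).
rewrite (_ : M * N * N ^ 2 = M * N ^ 3); last by ring.
by rewrite leq_mul2l up orbT.
Qed.

(** Two uses of Ruzsa's triangle inequality: replacing [I] by [U] costs a factor [#|U - U| / #|I|],
    and replacing [J] by [V] costs [#|V - V| / #|J|]. *)
Lemma comb_transfer (F : finFieldType) (a b : F) (U V I J : {set F}) :
  a != 0%R -> b != 0%R -> I \subset U -> J \subset V ->
  #|comb a U b V| * (#|I| * #|J|)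
    <= #|comb 1 U (-1) U| * #|comb a I b J| * #|comb 1 V (-1) V|.
Proof.
move=> a0 b0 IU JV.
have na0 : (- a != 0)%R by rewrite oppr_eq0.
have h1 : #|comb a U b J| * #|I| <= #|comb 1 U (-1) U| * #|comb a I b J|.
  apply: leq_trans (ruzsa_comb _ _ _ _ _ na0) _.
  rewrite card_comb_opp opprK leq_mul2r; apply/orP; right.
  rewrite -(@card_comb_scale _ a 1%R U (-1)%R) // mulr1 mulrN1.
  by apply/subset_leq_card/combS.
have h2 : #|comb a U b V| * #|J| <= #|comb a U b J| * #|comb 1 V (-1) V|.
  apply: leq_trans (ruzsa_comb _ _ _ _ _ b0) _.
  rewrite leq_mul2l; apply/orP; right.
  rewrite -(@card_comb_scale _ b 1%R V (-1)%R) // mulr1 mulrN1.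
  by apply/subset_leq_card/combS.
have -> : #|comb a U b V| * (#|I| * #|J|) = #|comb a U b V| * #|J| * #|I| by ring.
apply: (@leq_trans (#|comb a U b J| * #|comb 1 V (-1) V| * #|I|)).
  by rewrite leq_mul2r h2 orbT.
by rewrite mulnAC leq_mul2r h1 orbT.
Qed.

Lemma card_diffset_comb (F : finFieldType) (a b : F) (U V : {set F}) :
  a != 0%R -> b != 0%R ->
  #|comb 1 U (-1) U| * #|V| <= #|comb a U b V| ^ 2.
Proof.
move=> a0 b0; have := @ruzsa_comb _ a U b V (- a)%R U b0.
rewrite opprK [comb b V a U]combC mulnn.
by rewrite -(@card_comb_scale _ a 1%R U (-1)%R) // mulr1 mulrN1.
Qed.

(** The arithmetic that follows [sum_popular]: [t] is the full sum, [s] its popular part, and [l]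
    bounds [s] through the number of popular indices. *)
Lemma popular_sum_arith (m a b t s l : nat) :
  m <= a * t -> 2 * a <= b -> 2 * a * t <= m + 2 * a * s -> 2 * a * s <= b * l ->
  m <= b * l.
Proof. lia. Qed.

(** Each [l] has its own pair of sets. One pair [(U, V)], that of [l0], meets many of the others in
    a positive proportion, so [comb_transfer] makes [l U + (1 - l) V] small for all those [l].
    Comparing [l] with [l0] through [V] gives many multipliers of the single set [U], to which
    [small_diff_multipliers] applies. *)
Lemma bsg_family_bound : exists e : nat, forall (p N j : nat) (Y L : {set 'F_p})
    (UV : 'F_p -> {set 'F_p} * {set 'F_p}),
  prime p -> 1 < j -> 0 < N -> #|Y| <= N -> #|L| <= N -> N <= j * #|L| ->
  0%R \notin L -> 1%R \notin L ->
  {in L, forall l, [/\ (UV l).1 \subset Y, (UV l).2 \subset Y,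
     N <= j * #|(UV l).1|, N <= j * #|(UV l).2| &
     #|comb l (UV l).1 (1 - l) (UV l).2| <= j * N]} ->
  N ^ 2 <= j * p -> p <= 4 * N ^ 2 -> p <= j ^ e.
Proof.
have [e0 e0P] := small_diff_multipliers.
exists (2 * (44 * e0 + 44)) => p N j Y L UV p_pr j1 N0 YN LN NL L0 L1 UVP Np pN.
have j0 : 0 < j by apply: ltnW.
set M := (j ^ 44) ^ e0.
(* The two possible endings: a bound on [N], converted by [p <= 4 * N ^ 2], or a bound on [p]
   itself. *)
have small : N <= j ^ 14 * M \/ p <= j * M ^ 2 -> p <= j ^ (2 * (44 * e0 + 44)).
  have -> : j ^ (2 * (44 * e0 + 44)) = (j ^ 44 * M) ^ 2.
    by rewrite /M -expnM -expnD -expnM; congr (_ ^ _); ring.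
  have j44 m : m <= 44 -> j ^ m <= j ^ 44 by rewrite leq_exp2l.
  case=> [h|h].
    apply: (leq_trans pN); rewrite (_ : 4 * N ^ 2 = (2 * N) ^ 2); last by ring.
    rewrite leq_exp2r //; apply: (@leq_trans (2 * (j ^ 14 * M))).
      by rewrite leq_mul2l h.
    rewrite mulnA leq_mul2r; apply/orP; right.
    apply: (@leq_trans (j * j ^ 14)); first by rewrite leq_mul2r j1 orbT.
    by rewrite -expnS; apply: j44.
  apply: (leq_trans h); rewrite expnMn leq_mul2r; apply/orP; right.
  apply: (@leq_trans (j ^ 44)); first by rewrite -[X in X <= _]expn1; apply: j44.
  by rewrite -mulnn leq_pmull // expn_gt0 j0.
have Lgt : 0 < #|L| by rewrite lt0n; apply/eqP => L00; move: NL; rewrite L00 muln0 leqNgt N0.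
pose S l := setX (UV l).1 (UV l).2.
have SY : {in L, forall l, S l \subset setX Y Y}.
  move=> l /UVP[h1 h2 _ _ _]; apply/subsetP => -[a b]; rewrite !inE /=.
  by case/andP => /(subsetP h1) -> /(subsetP h2).
have [l0 l0L] := popular_intersection Lgt SY.
have [UY VY NU NV CUV] := UVP _ l0L.
set U := (UV l0).1 in UY NU CUV; set V := (UV l0).2 in VY NV CUV.
have SumS : N ^ 3 <= j ^ 3 * \sum_(i in L) #|S i|.
  rewrite (_ : N ^ 3 = N * N ^ 2); last by ring.
  apply: (@leq_trans (j * #|L| * N ^ 2)); first by rewrite leq_mul2r NL orbT.
  rewrite (_ : j * #|L| * N ^ 2 = j * (#|L| * N ^ 2)); last by ring.
  rewrite -sum_nat_const !big_distrr /=; apply: leq_sum => i /UVP[_ _ h1 h2 _].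
  rewrite cardsX (_ : j ^ 3 * _ = j * ((j * #|(UV i).1|) * (j * #|(UV i).2|))); last by ring.
  by rewrite leq_mul2l -mulnn leq_mul // orbT.
rewrite cardsX => cross.
set Sc := \sum_(i in L) #|_ :&: _| in cross.
have cross2 : N ^ 3 <= j ^ 6 * Sc.
  have h1 : (N ^ 3) ^ 2 <= j ^ 6 * (N * N * (N * Sc)).
    apply: (@leq_trans ((j ^ 3 * \sum_(i in L) #|S i|) ^ 2)).
      by rewrite leq_exp2r.
    rewrite expnMn -expnM leq_mul2l; apply/orP; right.
    by apply: (leq_trans cross); rewrite !leq_mul.
  have N3 : 0 < N ^ 3 by rewrite expn_gt0 N0.
  rewrite -(leq_pmul2r N3) mulnn; apply: (leq_trans h1); apply: eq_leq; ring.
pose L2 := [set l in L | N ^ 2 <= 2 * j ^ 6 * #|S l :&: S l0|].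
have L2L : L2 \subset L by apply/subsetP => l; rewrite inE => /andP[].
have j67 : 2 * j ^ 6 <= j ^ 7 by rewrite [j ^ 7]expnS leq_mul2r j1 orbT.
have NL2 : N <= j ^ 7 * #|L2|.
  have N2 : 0 < N ^ 2 by rewrite expn_gt0 N0.
  rewrite -(leq_pmul2r N2).
  have := @sum_popular _ L (fun l => #|S l :&: S l0|) N (2 * j ^ 6) (N ^ 2) LN.
  rewrite -/L2 -/Sc.
  have : \sum_(l in L2) #|S l :&: S l0| <= #|L2| * N ^ 2.
    rewrite -sum_nat_const; apply: leq_sum => l /(subsetP L2L) /SY h.
    apply: (@leq_trans #|setX Y Y|); last by rewrite cardsX -mulnn leq_mul.
    by apply: subset_leq_card; apply: subset_trans h; apply: subsetIl.
  move=> h3 h2; rewrite -mulnA; apply: (popular_sum_arith _ j67 h2).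
    by rewrite -expnS.
  by apply: leq_mul.
have UN : #|U| <= N by apply: leq_trans YN; apply: subset_leq_card.
have VN : #|V| <= N by apply: leq_trans YN; apply: subset_leq_card.
have U0 : 0 < #|U| by rewrite lt0n; apply/eqP => h; move: NU; rewrite h muln0 leqNgt N0.
have V0 : 0 < #|V| by rewrite lt0n; apply/eqP => h; move: NV; rewrite h muln0 leqNgt N0.
have lneq l : l \in L -> l != 0%R /\ (1 - l != 0)%R.
  move=> lL; split; first by apply: contraNneq L0 => <-.
  by rewrite subr_eq0; apply: contraNneq L1 => ->.
have [l00 l01] := lneq _ l0L.
have bound2 a b : a * #|V| <= (b * N) ^ 2 -> a <= b ^ 2 * j * N.
  move=> h; rewrite -(leq_pmul2r V0); apply: (leq_trans h).
  rewrite expnMn -mulnn mulnA -!mulnA !leq_mul2l; apply/orP; right.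
  have -> : j * (N * #|V|) = N * (j * #|V|) by ring.
  by rewrite leq_mul2l NV !orbT.
have DU : #|comb 1 U (-1) U| <= j ^ 3 * N.
  rewrite (_ : j ^ 3 = j ^ 2 * j); last by ring.
  apply: bound2; apply: (leq_trans (card_diffset_comb U V l00 l01)).
  by rewrite leq_exp2r.
have DV : #|comb 1 V (-1) V| <= j ^ 3 * N.
  rewrite -(leq_pmul2r U0).
  apply: (leq_trans (card_diffset_comb V U l01 l00)); rewrite combC.
  apply: (@leq_trans ((j * N) ^ 2)); first by rewrite leq_exp2r.
  rewrite (_ : j ^ 3 * N * #|U| = j ^ 2 * N * (j * #|U|)); last by ring.
  rewrite (_ : (j * N) ^ 2 = j ^ 2 * N * N); last by ring.
  by rewrite leq_mul2l NU orbT.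
have CL2 l : l \in L2 -> #|comb l U (1 - l) V| <= j ^ 21 * N.
  rewrite inE => /andP[lL pop]; have [h0 h1] := lneq _ lL.
  have [_ _ _ _ hc] := UVP _ lL.
  set I := (UV l).1 in hc; set J := (UV l).2 in hc.
  have IU : I :&: U \subset U by apply: subsetIr.
  have JV : J :&: V \subset V by apply: subsetIr.
  have IJ : N ^ 2 <= j ^ 7 * (#|I :&: U| * #|J :&: V|).
    apply: (leq_trans pop); apply: leq_mul => //; rewrite -cardsX.
    apply: subset_leq_card; apply/subsetP => -[a b]; rewrite !inE /=.
    by case/andP => /andP[-> ->] /andP[-> ->].
  have := comb_transfer h0 h1 IU JV.
  have : #|comb l (I :&: U) (1 - l) (J :&: V)| <= j * N.
    by apply: leq_trans hc; apply: subset_leq_card; apply: combS; apply: subsetIl.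
  move: (#|comb _ (_ :&: _) _ _|) => c hcc.
  move=> h2; have IJgt : 0 < N ^ 2 by rewrite expn_gt0 N0.
  rewrite -(leq_pmul2r IJgt).
  apply: (@leq_trans (#|comb l U (1 - l) V| * (j ^ 7 * (#|I :&: U| * #|J :&: V|)))).
    by rewrite leq_mul2l IJ orbT.
  rewrite mulnCA; apply: (@leq_trans (j ^ 7 * (j ^ 3 * N * (j * N) * (j ^ 3 * N)))).
    by rewrite leq_mul2l (leq_trans h2) ?orbT // !leq_mul.
  rewrite (_ : _ * _ = (j ^ 7 * j ^ 3 * j * j ^ 3) * N * N ^ 2); last by ring.
  rewrite -expnD -expnSr -expnD; do 2! apply: leq_mul => //.
  by rewrite leq_exp2l.
(* Up to dilation [l U + (1 - l) V] is [U + rho l V]. With [s = rho l / rho l0], the set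
   [rho l V + s U] is a dilate of [U + rho l0 V], so the triangle inequality through [rho l V]
   bounds [U - s U]. *)
pose rho l : 'F_p := ((1 - l) / l)%R.
have Crho l : l \in L -> #|comb 1 U (rho l) V| = #|comb l U (1 - l) V|.
  move=> /lneq[h0 _]; rewrite -(@card_comb_scale _ l 1%R U) // mulr1.
  by rewrite mulrC divfK.
pose Sg := [set (rho l / rho l0)%R | l in L2].
have rho0 l : l \in L -> rho l != 0%R.
  by move=> /lneq[h0 h1]; rewrite mulf_neq0 ?invr_neq0.
have cSg : #|Sg| = #|L2|.
  apply: card_in_imset => a b /(subsetP L2L) aL /(subsetP L2L) bL.
  have [a0 _] := lneq _ aL; have [b0 _] := lneq _ bL.
  move/(mulIf (invr_neq0 (rho0 _ l0L))); rewrite /rho !mulrBl !mul1r !mulfV //.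
  by move/addIr/invr_inj.
have gSg : {in Sg, forall s, small_diff (j ^ 44) U s}.
  move=> _ /imsetP[l lL2 ->]; have lL := subsetP L2L _ lL2.
  set s := (_ / _)%R; rewrite /small_diff.
  have h1 := @ruzsa_comb _ 1%R U (rho l) V (- s)%R U (rho0 _ lL).
  have h2 : #|comb (rho l) V (- - s) U| = #|comb 1 U (rho l0) V|.
    rewrite opprK -(@card_comb_scale _ (rho l / rho l0)%R 1%R U (rho l0)) //.
      by rewrite mulr1 divfK ?rho0 // combC.
    by rewrite mulf_neq0 ?invr_neq0 ?rho0.
  rewrite h2 !Crho // in h1.
  apply: (@leq_trans ((j ^ 21) ^ 2 * j * N)).
    apply: bound2; apply: (leq_trans h1); rewrite -mulnn; apply: leq_mul.
      exact: CL2.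
    apply: (leq_trans CUV); rewrite leq_mul2r; apply/orP; right.
    by rewrite -[X in X <= _]expn1 leq_exp2l.
  rewrite -expnM -expnSr [j ^ 44]expnSr -mulnA leq_mul //.
have [S1|S1] := leqP #|Sg| 1.
  apply: small; left; apply: (leq_trans NL2); rewrite -cSg.
  apply: (@leq_trans (j ^ 7)); first by rewrite -[X in _ <= X]muln1 leq_mul2l S1 orbT.
  apply: (@leq_trans (j ^ 14)); first by rewrite leq_exp2l.
  by rewrite leq_pmulr // /M !expn_gt0 j0.
have Un0 : U != set0 by rewrite -card_gt0.
have j441 : 1 < j ^ 44 by rewrite -[X in X < _](expn0 j) ltn_exp2l.
apply: small; rewrite cSg in S1.
have := e0P p (j ^ 44) U Sg p_pr j441 Un0 _ gSg; rewrite -/M cSg => /(_ S1).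
have M0 : 0 < M by rewrite /M !expn_gt0 j0.
have j14 m : m <= 14 -> j ^ m <= j ^ 14 by rewrite leq_exp2l.
case=> [Usmall|].
  left; apply: (leq_trans NU); apply: leq_mul => //.
  by rewrite -[X in X <= _]expn1; apply: j14.
rewrite geq_min => /orP[h|h].
  left; have : N ^ 2 <= j ^ 14 * M * N.
    apply: (@leq_trans ((j ^ 7 * #|L2|) ^ 2)); first by rewrite leq_exp2r.
    rewrite expnMn -expnM -mulnA leq_mul2l; apply/orP; right.
    by apply: (leq_trans h); rewrite leq_mul2l UN orbT.
  by rewrite -mulnn leq_pmul2r.
right; have p0 : 0 < p by apply: prime_gt0.
rewrite -(leq_pmul2r p0).
apply: (@leq_trans ((M * N) ^ 2)).
  by rewrite mulnn leq_exp2r // (leq_trans h) // leq_mul2l UN orbT.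
by rewrite expnMn mulnAC mulnC leq_mul2r Np orbT.
Qed.

Lemma affine_family_bound : exists e : nat, forall (p N K : nat) (Y L : {set 'F_p}),
  prime p -> 1 < K -> #|Y| <= N -> #|L| <= N -> 0%R \notin L -> 1%R \notin L ->
  N ^ 3 <= K * \sum_(l in L)
    #|[set z in setX Y Y | (l * z.1 + (1 - l) * z.2)%R \in Y]| ->
  N ^ 2 <= K * p -> p <= 4 * N ^ 2 -> p <= K ^ e.
Proof.
have [e eP] := bsg_family_bound; exists (25 * e) => p N K Y L p_pr K1 YN LN L0 L1.
pose f (l : 'F_p) := #|[set z in setX Y Y | (l * z.1 + (1 - l) * z.2)%R \in Y]|.
move=> rich Np pN.
have {}rich : N ^ 3 <= K * \sum_(l in L) f l := rich.
have K0 : 0 < K by apply: ltnW.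
have N0 : 0 < N.
  by rewrite lt0n; apply: contraTneq pN => ->; rewrite -ltnNge prime_gt0.
have fN l : f l <= N ^ 2.
  apply: (@leq_trans #|setX Y Y|); last by rewrite cardsX -mulnn leq_mul.
  by apply: subset_leq_card; apply/subsetP => z; rewrite inE => /andP[].
pose L' := [set l in L | N ^ 2 <= 2 * K * f l].
have L'L : L' \subset L by apply/subsetP => l; rewrite inE => /andP[].
have NL : N <= 2 * K * #|L'|.
  have N2 : 0 < N ^ 2 by rewrite expn_gt0 N0.
  rewrite -(leq_pmul2r N2) -mulnA.
  have h1 : 2 * K * \sum_(l in L') f l <= 2 * K * (#|L'| * N ^ 2).
    by rewrite leq_mul2l -sum_nat_const leq_sum ?orbT // => l _.
  apply: (popular_sum_arith _ (leqnn _) (sum_popular f (2 * K) (N ^ 2) LN) h1).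
  by rewrite -expnS.
(* The largest constant of [bsg_comb] here is [48 * 512 * (2 K) ^ 5 <= 2 ^ 20 * K ^ 5], and
   [2 <= K]. *)
set j := K ^ 25.
have twoK n : 2 ^ n <= K ^ n by case: n => // n; rewrite leq_exp2r.
have Kj m n : m + n <= 25 -> 2 ^ m * K ^ n <= j.
  move=> mn; apply: (@leq_trans (K ^ m * K ^ n)); first by rewrite leq_mul2r twoK orbT.
  by rewrite -expnD leq_exp2l.
have j1 : 1 < j by apply: leq_trans (Kj 1 0 isT).
have /fin_all_exists[UV UVP] : forall l, exists UV : {set 'F_p} * {set 'F_p},
    l \in L' -> [/\ UV.1 \subset Y, UV.2 \subset Y,
     N <= j * #|UV.1|, N <= j * #|UV.2| &
     #|comb l UV.1 (1 - l) UV.2| <= j * N].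
  move=> l; case: (boolP (l \in L')) => [lL'|]; last by exists (Y, Y).
  have lL := subsetP L'L _ lL'.
  have l0 : l != 0%R by apply: contraNneq L0 => <-.
  have l1 : l != 1%R by apply: contraNneq L1 => <-.
  have pop : N ^ 2 <= 2 * K * f l by move: lL'; rewrite inE => /andP[].
  have [UVl [h1 h2 h3 h4 h5]] := bsg_comb l0 l1 N0 YN pop.
  exists UVl => _; split=> //.
  - apply: (leq_trans h3); rewrite leq_mul2r; apply/orP; right.
    apply: leq_trans (Kj 4 1 isT); rewrite expn1 mulnA leq_mul2r; by rewrite orbT.
  - apply: (leq_trans h4); rewrite leq_mul2r; apply/orP; right.
    by apply: leq_trans (Kj 3 1 isT); rewrite expn1 mulnA leq_mul2r orbT.
  - apply: (leq_trans h5); rewrite leq_mul2r; apply/orP; right.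
    rewrite expnMn mulnA; apply: leq_trans (Kj 20 5 isT).
    rewrite leq_mul2r; apply/orP; right.
    rewrite (expnD 2 15 5) leq_mul2r; apply/orP; right.
    by rewrite (expnD 2 6 9); apply: leq_mul.
rewrite expnM; apply: (eP p N j Y L' UV) => //.
- by apply: leq_trans LN; apply: subset_leq_card.
- apply: (leq_trans NL); rewrite leq_mul2r; apply/orP; right.
  exact: (Kj 1 1 isT).
- by apply: contra L0 => /(subsetP L'L).
- by apply: contra L1 => /(subsetP L'L).
- apply: (leq_trans Np); rewrite leq_mul2r; apply/orP; right.
  by rewrite -[X in X <= _]mul1n -[X in _ * X]expn1; apply: (Kj 0 1).
Qed.

(** * Moebius involutions and their products *)

Section Words.
Local Open Scope ring_scope.
Variables (F : finFieldType) (k : F).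
Hypotheses (k0 : k != 0) (k1 : k != 1) (two0 : 2%:R != 0 :> F).

(* [step b] is the Moebius involution of the traceless matrix
   [[b, - (1 - k) b^2], [1, - b]]; it is only meaningful for [x != b], since
   [step b b = b] by the convention [1 / 0 = 0]. *)
Definition step (b x : F) : F := b + k * b ^+ 2 / (x - b).

Lemma step_neq b x : b != 0 -> x != b -> step b x != b.
Proof.
move=> b0 xb; rewrite /step -subr_eq0 addrAC subrr add0r.
by rewrite !mulf_neq0 ?invr_neq0 ?subr_eq0.
Qed.

Lemma stepK b x : b != 0 -> x != b -> step b (step b x) = x.
Proof.
move=> b0 xb; have d0 : x - b != 0 by rewrite subr_eq0.
rewrite /step addrAC subrr add0r invf_div.
rewrite mulrA [k * _ * _]mulrC -mulrA mulfV; first by rewrite mulr1 addrC subrK.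
by rewrite mulf_neq0 // expf_neq0.
Qed.

(* Entries [[wP, wQ], [wR, wS]] of the matrix of [step b \o step c \o step d]. *)
Definition wP (b c d : F) :=
  b * (c - (1 - k) * b) * d + (1 - k) * b * c * (b - c).
Definition wQ (b c d : F) :=
  - (b * (c - (1 - k) * b) * ((1 - k) * d ^+ 2)) - d * ((1 - k) * b * c * (b - c)).
Definition wR (b c d : F) := (c - b) * d + c * (b - (1 - k) * c).
Definition wS (b c d : F) :=
  - ((c - b) * ((1 - k) * d ^+ 2)) - d * (c * (b - (1 - k) * c)).

(** Nonzero letters make the determinant nonzero and distinct letters the trace. The condition on
    [wR], that infinity is not fixed, permits the normalisation in [mobius]. *)
Definition good_word (w : F * F * F) :=
  [&& w.1.1 != 0, w.1.2 != 0, w.2 != 0, w.1.1 != w.1.2, w.1.2 != w.2,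
      w.1.1 != w.2 & wR w.1.1 w.1.2 w.2 != 0].

Definition walk (w : F * F * F) x := step w.1.1 (step w.1.2 (step w.2 x)).

(** No step is taken at its pole, so the convention [1 / 0 = 0] never intervenes. *)
Definition walkable (w : F * F * F) x :=
  [&& x != w.2, step w.2 x != w.1.2 & step w.1.2 (step w.2 x) != w.1.1].

(** The matrix scaled to lower left entry [1], so that proportional matrices give the same
    triple. *)
Definition mobius (w : F * F * F) : F * F * F :=
  (wP w.1.1 w.1.2 w.2 / wR w.1.1 w.1.2 w.2,
   wQ w.1.1 w.1.2 w.2 / wR w.1.1 w.1.2 w.2,
   wS w.1.1 w.1.2 w.2 / wR w.1.1 w.1.2 w.2).

Lemma walkE w x : good_word w -> walkable w x ->
  x + (mobius w).2 != 0 /\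
  walk w x = ((mobius w).1.1 * x + (mobius w).1.2) / (x + (mobius w).2).
Proof.
case: w => -[b c] d; rewrite /good_word /walkable /walk /mobius /=.
case/and5P => b0 c0 d0 bc /and3P[cd bd r0] /and3P[xd tc sb].
have h1 : x - d != 0 by rewrite subr_eq0.
have h2 : (d - c) * (x - d) + k * d ^+ 2 != 0.
  have -> : (d - c) * (x - d) + k * d ^+ 2 = (step d x - c) * (x - d).
    by rewrite /step; field.
  by rewrite mulf_neq0 // subr_eq0.
have Et : step d x - c = ((d - c) * (x - d) + k * d ^+ 2) / (x - d).
  by rewrite /step; field.
have Es : step c (step d x) - b =
    (wR b c d * x + wS b c d) / ((d - c) * (x - d) + k * d ^+ 2).
  rewrite {1}/step Et /wR /wS; field.
  by rewrite h2 h1.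
have h3 : wR b c d * x + wS b c d != 0.
  have : step c (step d x) - b != 0 by rewrite subr_eq0.
  by rewrite Es mulf_eq0 negb_or => /andP[].
have h4 : x + wS b c d / wR b c d != 0.
  have -> : x + wS b c d / wR b c d = (wR b c d * x + wS b c d) / wR b c d.
    by field.
  by rewrite mulf_neq0 // invr_neq0.
split=> //; rewrite {1}/step Es.
have -> : (wP b c d / wR b c d * x + wQ b c d / wR b c d) /
    (x + wS b c d / wR b c d) =
    (wP b c d * x + wQ b c d) / (wR b c d * x + wS b c d).
  by field; rewrite r0 h3.
apply: (mulIf h3); rewrite mulrDl [in RHS]mulfVK //.
rewrite invf_div mulrA mulfVK // /wP /wQ /wR /wS; ring.
Qed.

(** The matrix of [step b] has determinant [- k b^2], so a product of three has
    [- k^3 (b c d)^2]. *)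
Lemma good_word_det w : good_word w ->
  (mobius w).1.1 * (mobius w).2 - (mobius w).1.2 != 0.
Proof.
case: w => -[b c] d; rewrite /good_word /mobius /=.
case/and5P => b0 c0 d0 bc /and3P[cd bd r0].
have -> : wP b c d / wR b c d * (wS b c d / wR b c d) - wQ b c d / wR b c d =
   (wP b c d * wS b c d - wQ b c d * wR b c d) / wR b c d ^+ 2 by field.
have -> : wP b c d * wS b c d - wQ b c d * wR b c d = - (k ^+ 3 * (b * c * d) ^+ 2).
  by rewrite /wP /wQ /wS /wR; ring.
by rewrite mulf_neq0 ?invr_neq0 ?expf_neq0 // oppr_eq0 !mulf_neq0 ?expf_neq0 ?mulf_neq0.
Qed.

(* The trace of a product of three of the involutions is a Vandermonde
   determinant. *)
Lemma good_word_trace w : good_word w -> (mobius w).1.1 + (mobius w).2 != 0.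
Proof.
case: w => -[b c] d; rewrite /good_word /mobius /=.
case/and5P => b0 c0 d0 bc /and3P[cd bd r0].
rewrite -mulrDl mulf_neq0 ?invr_neq0 //.
have -> : wP b c d + wS b c d = (1 - k) * ((b - c) * (c - d) * (b - d)).
  by rewrite /wP /wS; ring.
by rewrite !mulf_neq0 // subr_eq0 // eq_sym.
Qed.

End Words.

Section Words.
Local Open Scope ring_scope.
Variables (F : finFieldType) (k : F).
Hypotheses (k0 : k != 0) (k1 : k != 1) (two0 : 2%:R != 0 :> F).

Lemma card_rootsPoly (s : seq F) i : s`_i != 0 ->
  (#|[set x | (Poly s).[x] == 0%R]| <= (size s).-1)%N.
Proof.
move=> si.
have Ps0 : Poly s != 0.
  by apply: contraNneq si => e; rewrite -(coef_Poly s i) e coef0.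
have := max_poly_roots Ps0 (rs := enum [set x | (Poly s).[x] == 0%R]).
rewrite -cardE enum_uniq => h.
have {}h : (#|[set x | (Poly s).[x] == 0%R]| < size (Poly s))%N.
  by apply: h => //; apply/allP => x; rewrite mem_enum inE.
by rewrite -ltnS; apply: leq_trans h (leq_trans (size_Poly s) (leqSpred _)).
Qed.

(* The numbers [d] for which the Moebius map [(P x + Q) / (x + S)] composed with
   [step d] is a product of two steps are among the roots of this quartic. *)
Definition quartic (P Q S : F) : seq F :=
  let m := 1 - k in let D := P * S - Q in let B := (2%:R + m) * P * S - Q in
  [:: k * (Q * S) ^+ 2 + D * Q ^+ 2;
      2%:R * k * B * Q * S + 2%:R * D * (P - S) * Q;
      k * (B ^+ 2 + 2%:R * m * P * Q * S) + D * ((P - S) ^+ 2 - 2%:R * m * Q);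
      2%:R * k * m * P * B - 2%:R * D * m * (P - S);
      k * m ^+ 2 * P ^+ 2 + D * m ^+ 2].

(** If the three top coefficients vanish, they give in turn [D = - k P^2], [B = - P (P - S)] and
    [Q = 0]. Then [P = - (2 - k) S] and [S = - k P], hence [(k - 1)^2 S = 0], which is excluded. *)
Lemma quartic_neq0 P Q S : P * S - Q != 0 -> P + S != 0 ->
  exists i, (quartic P Q S)`_i != 0.
Proof.
move=> D0 T0.
have m0 : 1 - k != 0 by rewrite subr_eq0 eq_sym.
case: (eqVneq (quartic P Q S)`_4 0) => [c4|]; last by exists 4.
case: (eqVneq (quartic P Q S)`_3 0) => [c3|]; last by exists 3.
case: (eqVneq (quartic P Q S)`_2 0) => [c2|]; last by exists 2.
exfalso; move: c4 c3 c2; rewrite /quartic /=.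
set m := 1 - k in m0 *; set B := (2%:R + m) * P * S - Q; set D := P * S - Q in D0 * => c4 c3 c2.
have DE : D = - k * P ^+ 2.
  apply: (mulIf (expf_neq0 2 m0)); rewrite -[LHS]subr0 -c4; ring.
have P0 : P != 0.
  by apply: contraNneq D0 => P0; rewrite DE P0 expr0n mulr0.
have BE : B = - P * (P - S).
  have h : 2%:R * k * m * P != 0 by rewrite !mulf_neq0.
  apply: (mulfI h); rewrite -[LHS]subr0 -c3 DE; ring.
have Q0 : Q = 0.
  have h : 2%:R * k * m * P * (P + S) != 0 by rewrite !mulf_neq0.
  apply: (mulfI h); rewrite mulr0 -c2 BE DE; ring.
have S0 : S != 0.
  by apply: contraNneq D0 => S0; rewrite /D S0 Q0 mulr0 subr0.
have PS : P = - (1 + m) * S.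
  apply: (mulfI P0); move: BE; rewrite /B Q0 subr0 => e.
  have -> : P * P = P * S - (- P * (P - S)) by ring.
  rewrite -e; ring.
have SP : S = - k * P.
  apply: (mulfI P0); move: DE; rewrite /D Q0 subr0 => ->; ring.
have : (k - 1) ^+ 2 * S = 0.
  have -> : (k - 1) ^+ 2 * S = S - k * (1 + m) * S by rewrite /m; ring.
  rewrite [in X in X - _]SP PS; ring.
move/eqP; rewrite mulf_eq0 (negbTE S0) orbF expf_eq0 /= subr_eq0.
by rewrite (negbTE k1).
Qed.

(** Cleared of denominators, the quartic at [d] is [k f^2 + (p s - q r) g^2] with
    [f = - (k b c d) g] and [p s - q r = - k^3 (b c d)^2], so its two terms cancel. *)
Lemma good_word_quartic w : good_word k w ->
  (Poly (quartic (mobius k w).1.1 (mobius k w).1.2 (mobius k w).2)).[w.2] = 0.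
Proof.
case: w => -[b c] d; rewrite horner_Poly /good_word /mobius /=.
case/and5P => b0 c0 d0 bc /and3P[cd bd r0].
set p := wP k b c d; set q := wQ k b c d; set s := wS k b c d.
set r := wR k b c d in r0 *.
transitivity ((k * ((1 - k) * p * r * d ^+ 2 + ((3%:R - k) * p * s - q * r) * d + q * s) ^+ 2
   + (p * s - q * r) * (- (1 - k) * r * d ^+ 2 + (p - s) * d + q) ^+ 2) / r ^+ 4).
  by field.
suff -> : k * ((1 - k) * p * r * d ^+ 2 + ((3%:R - k) * p * s - q * r) * d + q * s) ^+ 2
   + (p * s - q * r) * (- (1 - k) * r * d ^+ 2 + (p - s) * d + q) ^+ 2 = 0.
  by rewrite mul0r.
have -> : p * s - q * r = - (k ^+ 3 * (b * c * d) ^+ 2).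
  by rewrite /p /q /s /r /wP /wQ /wS /wR; ring.
have -> : (1 - k) * p * r * d ^+ 2 + ((3%:R - k) * p * s - q * r) * d + q * s =
  - (k * b * c * d) * (- (1 - k) * r * d ^+ 2 + (p - s) * d + q).
  by rewrite /p /q /s /r /wP /wQ /wS /wR; ring.
ring.
Qed.

(** The matrix of [step d] sends [d] to infinity and that of [step c] sends infinity to [c], so the
    image [t] of [d] is [step b c]. Since [e] is [b c], eliminating [c] leaves this cubic for
    [b]. *)
Definition cubic (P Q S d : F) : seq F :=
  let m := 1 - k in
  let t := (P * d + Q) / (d + S) in
  let e := d * (m * P * d + Q) / (m * (d + S)) in
  [:: - (t * e); e; t; - m].

Lemma good_word_cubic w : good_word k w ->
  w.1.1 * w.1.2 = w.2 * ((1 - k) * (mobius k w).1.1 * w.2 + (mobius k w).1.2)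
      / ((1 - k) * (w.2 + (mobius k w).2)) /\
  (Poly (cubic (mobius k w).1.1 (mobius k w).1.2 (mobius k w).2 w.2)).[w.1.1]
    = 0.
Proof.
case: w => -[b c] d; rewrite horner_Poly /good_word /mobius /=.
case/and5P => b0 c0 d0 bc /and3P[cd bd r0].
have m0 : 1 - k != 0 by rewrite subr_eq0 eq_sym.
have cb0 : c - b != 0 by rewrite subr_eq0 eq_sym.
have E1 : d + wS k b c d / wR k b c d = (c - b) * (k * d ^+ 2) / wR k b c d.
  have -> : (c - b) * (k * d ^+ 2) = wR k b c d * d + wS k b c d.
    by rewrite /wS /wR; ring.
  by field.
have E2 : wP k b c d / wR k b c d * d + wQ k b c d / wR k b c d
    = b * (c - (1 - k) * b) * (k * d ^+ 2) / wR k b c d.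
  have -> : b * (c - (1 - k) * b) * (k * d ^+ 2) = wP k b c d * d + wQ k b c d.
    by rewrite /wP /wQ; ring.
  by field.
have E3 : (1 - k) * (wP k b c d / wR k b c d) * d + wQ k b c d / wR k b c d
    = (1 - k) * b * c * (c - b) * (k * d) / wR k b c d.
  have -> : (1 - k) * b * c * (c - b) * (k * d) =
      (1 - k) * wP k b c d * d + wQ k b c d by rewrite /wP /wQ; ring.
  by field.
rewrite E1 E2 E3; move: (wR k b c d) r0 => r r0.
have -> : d * ((1 - k) * b * c * (c - b) * (k * d) / r) /
    ((1 - k) * ((c - b) * (k * d ^+ 2) / r)) = b * c.
  by field; rewrite k0 d0 r0 cb0 m0.
split=> //.
have -> : b * (c - (1 - k) * b) * (k * d ^+ 2) / r / ((c - b) * (k * d ^+ 2) / r)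
    = b * (c - (1 - k) * b) / (c - b).
  by field; rewrite k0 d0 r0 cb0.
by field.
Qed.

(** At most four values of [d] by the quartic, three of [b] for each [d] by the cubic, and then [c]
    from the product [b c]. *)
Lemma card_good_words m :
  (#|[set w | good_word k w & mobius k w == m]| <= 12)%N.
Proof.
case: (set_0Vmem [set w | good_word k w & mobius k w == m]) => [->|[w0]].
  by rewrite cards0.
rewrite in_set => /andP[gw0 /eqP mw0].
have := quartic_neq0 (good_word_det k0 gw0) (good_word_trace k1 gw0).
rewrite mw0 => -[i qi].
have m0 : 1 - k != 0 by rewrite subr_eq0 eq_sym.
pose D := [set x | (Poly (quartic m.1.1 m.1.2 m.2)).[x] == 0].
apply: (@leq_trans (3 * #|D|)%N); last first.
  by rewrite -[12%N]/(3 * 4)%N leq_mul2l (card_rootsPoly qi).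
apply: (@card_le_fibers _ _ _ _ (fun w => w.2)).
  move=> w; rewrite in_set => /andP[gw /eqP mw].
  by rewrite /D in_set -mw good_word_quartic.
move=> d _; pose C := [set x | (Poly (cubic m.1.1 m.1.2 m.2 d)).[x] == 0].
have C3 : (#|C| <= 3)%N.
  by apply: (@card_rootsPoly _ 3); rewrite /= oppr_eq0.
rewrite -[3%N]/(1 * 3)%N; apply: leq_trans (leq_mul (leqnn 1) C3).
apply: (@card_le_fibers _ _ _ _ (fun w => w.1.1)).
  move=> w /setIdP[]; rewrite in_set => /andP[gw /eqP mw] /eqP wd.
  by rewrite /C in_set -mw -wd; have [_ ->] := good_word_cubic gw.
move=> b _; apply/card_le1_eqP => w w'.
case/setIdP => /setIdP[]; rewrite in_set => /andP[gw /eqP mw] /eqP wd /eqP wb.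
case/setIdP => /setIdP[]; rewrite in_set => /andP[gw' /eqP mw'] /eqP wd' /eqP wb'.
have [e _] := good_word_cubic gw; have [e' _] := good_word_cubic gw'.
have b0 : b != 0 by rewrite -wb; case/andP: gw.
have : b * w.1.2 = b * w'.1.2.
  by rewrite -{1}wb e -[in RHS]wb' e' mw mw' wd wd'.
move/(mulfI b0) => ec; move: wd wd' wb wb' ec.
by case: w w' {gw gw' mw mw' e e'} => -[? ?] ? [[? ?] ?] /= -> -> -> -> ->.
Qed.

(** Cross-multiplied, the agreement says that a quadratic polynomial has three roots, so its
    coefficients vanish; the nonzero determinant then forces equal triples. *)
Lemma mobius_inj3 w w' x0 x1 x2 :
  good_word k w -> good_word k w' -> x0 != x1 -> x0 != x2 -> x1 != x2 ->
  {in [:: x0; x1; x2], forall x, [/\ walkable k w x, walkable k w' x &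
     walk k w x = walk k w' x]} -> mobius k w = mobius k w'.
Proof.
move=> gw gw' x01 x02 x12 agree.
have eqs x : x \in [:: x0; x1; x2] ->
    ((mobius k w).1.1 * x + (mobius k w).1.2) * (x + (mobius k w').2) =
    ((mobius k w').1.1 * x + (mobius k w').1.2) * (x + (mobius k w).2).
  move=> /agree[h h' e].
  have [n0 E] := walkE gw h; have [n0' E'] := walkE gw' h'.
  by apply/eqP; rewrite -eqr_div // -E -E' e.
have det := good_word_det k0 gw.
move: eqs det; case: (mobius k w) => -[P Q] S0; case: (mobius k w') => -[P' Q'] S'.
move=> /= eqs det.
pose a := P - P'; pose b := P * S' + Q - P' * S0 - Q'; pose c := Q * S' - Q' * S0.
have qz x : x \in [:: x0; x1; x2] -> a * x ^+ 2 + b * x + c = 0.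
  move/eqs/eqP; rewrite -subr_eq0 => /eqP <-; rewrite /a /b /c; ring.
have z0 : a * x0 ^+ 2 + b * x0 + c = 0 by apply: qz; rewrite !inE eqxx.
have z1 : a * x1 ^+ 2 + b * x1 + c = 0 by apply: qz; rewrite !inE eqxx orbT.
have z2 : a * x2 ^+ 2 + b * x2 + c = 0 by apply: qz; rewrite !inE eqxx !orbT.
have d01 : x0 - x1 != 0 by rewrite subr_eq0.
have d02 : x0 - x2 != 0 by rewrite subr_eq0.
have d12 : x1 - x2 != 0 by rewrite subr_eq0.
have e1 : a * (x0 + x1) + b = 0.
  apply: (mulfI d01); rewrite mulr0 -[RHS](subrr (0 : F)) -{1}z0 -z1; ring.
have e2 : a * (x0 + x2) + b = 0.
  apply: (mulfI d02); rewrite mulr0 -[RHS](subrr (0 : F)) -{1}z0 -z2; ring.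
have a0 : a = 0.
  apply: (mulfI d12); rewrite mulr0 -[RHS](subrr (0 : F)) -{1}e1 -e2; ring.
have b0 : b = 0 by move: e1; rewrite a0 mul0r add0r.
have c0 : c = 0 by move: z0; rewrite a0 b0 !mul0r !add0r.
have PP : P = P' by apply/eqP; rewrite -subr_eq0 -/a a0.
have QQ : Q' = Q + P * (S' - S0).
  by apply/eqP; rewrite -subr_eq0 -oppr_eq0 -b0 /b -PP; apply/eqP; ring.
have SS : S' = S0.
  apply/eqP; rewrite -subr_eq0; apply: contraTT isT => h; move: c0.
  have -> : c = - (P * S0 - Q) * (S' - S0) by rewrite /c QQ; ring.
  by move/eqP; rewrite mulf_eq0 oppr_eq0 (negbTE det) (negbTE h).
by rewrite PP QQ SS subrr mulr0 addr0.
Qed.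

(** Sending [x0] and its image to infinity turns the Moebius map into an affine map from [u] to [v],
    which preserves the affine relation with coefficient [l]. *)
Lemma walk_affine w x0 x1 x2 x3 :
  good_word k w -> x0 != x1 -> x0 != x2 -> x0 != x3 -> x1 != x2 ->
  {in [:: x0; x1; x2; x3], forall x, walkable k w x} ->
  let u x := (x - x0)^-1 in let v x := (walk k w x - walk k w x0)^-1 in
  let l := (u x3 - u x2) / (u x1 - u x2) in
  l * v x1 + (1 - l) * v x2 = v x3.
Proof.
move=> gw x01 x02 x03 x12 wk u v l.
have det := good_word_det k0 gw.
have [n0 E0] : _ := walkE gw (wk x0 (mem_head _ _)).
set P := (mobius k w).1.1 in det E0 *; set Q := (mobius k w).1.2 in det E0 *.
set S0 := (mobius k w).2 in det n0 E0 *.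
have vE x : x \in [:: x0; x1; x2; x3] -> x0 != x ->
    v x = (x0 + S0) ^+ 2 / (P * S0 - Q) * u x + (x0 + S0) / (P * S0 - Q).
  move=> /wk /(walkE gw)[n E] xx; rewrite /v E E0 -/P -/Q -/S0 in n *.
  have d : x - x0 != 0 by rewrite subr_eq0 eq_sym.
  have -> : (P * x + Q) / (x + S0) - (P * x0 + Q) / (x0 + S0) =
      (P * S0 - Q) * (x - x0) / ((x + S0) * (x0 + S0)).
    by field; rewrite n n0.
  by rewrite /u; field; rewrite d n n0 det.
have d12 : u x1 - u x2 != 0.
  rewrite subr_eq0 /u; apply: contra x12 => /eqP/invr_inj/addIr ->.
  exact: eqxx.
rewrite !vE ?inE ?eqxx ?orbT //.
have -> : u x3 = l * u x1 + (1 - l) * u x2 by rewrite /l; field.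
ring.
Qed.
End Words.

(** * Counting walks *)

Lemma popular_point (T T' : finType) (P : {set T}) (S : T -> {set T'})
    (D : {set T'}) (N M : nat) :
  #|D| <= N -> 0 < #|P| -> 0 < N ->
  {in P, forall w, S w \subset D /\ N <= M * #|S w|} ->
  exists2 x, x \in D & #|P| <= M * #|[set w in P | x \in S w]|.
Proof.
move=> DN P0 N0 SP.
have D0 : 0 < #|D|.
  case/card_gt0P: P0 => w /SP[/subset_leq_card SD NS]; apply: leq_trans SD.
  by rewrite lt0n; apply: contraTneq NS => ->; rewrite muln0 -ltnNge.
have [x xD xP] := sum_exists_le (fun x => #|[set w in P | x \in S w]|) D0.
exists x => //; rewrite -(leq_pmul2r N0).
have ES : \sum_(w in P) #|S w| = \sum_(x in D) #|[set w in P | x \in S w]|.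
  rewrite -(sum_card_exchange P D (fun w x => x \in S w)).
  apply: eq_bigr => w /SP[/subsetP SD _]; congr #|pred_of_set _|.
  by apply/setP => z; rewrite inE; case: (boolP (z \in S w)) => [/SD ->|];
    rewrite ?andbF.
apply: (@leq_trans (M * \sum_(w in P) #|S w|)).
  by rewrite -sum_nat_const big_distrr /=; apply: leq_sum => w /SP[].
rewrite -mulnA leq_mul2l; apply/orP; right; rewrite ES.
by apply: (leq_trans xP); rewrite mulnC leq_mul2l DN orbT.
Qed.

Section Counting.
Variables (F : finFieldType) (k : F).
Hypotheses (k0 : k != 0%R) (k1 : k != 1%R) (two0 : (2%:R != 0 :> F)%R).
Variables (X Y B : {set F}) (N K : nat).
Hypotheses (XN : #|X| <= N) (YN : #|Y| <= N) (BN : #|B| <= N) (B0 : 0%R \notin B).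

Let E := [set z in setX Y B | (z.1 != z.2) && (step k z.2 z.1 \in X)].

Hypothesis dense : N ^ 2 <= K * #|E|.

Definition walks (w : F * F * F) :=
  [set x in X | [&& walkable k w x, step k w.2 x \in Y,
     step k w.1.2 (step k w.2 x) \in X & walk k w x \in Y]].

Let BBB := setX (setX B B) B.

Lemma in_B_neq0 b : b \in B -> b != 0%R.
Proof. by move=> bB; apply: contraNneq B0 => <-. Qed.

(** A walk is built from its middle edge [(t, c)], extended by [d] at [t] and by [b] at [step c t];
    as [step d] is an involution, it starts at [step d t]. Edges with an end of low degree are
    discarded, and at least [N ^ 2 / (2 K)] edges remain. *)
Lemma many_walks : N ^ 4 <= 32 * K ^ 3 * \sum_(w in BBB) #|walks w|.
Proof.
pose DY t := [set d in B | (t != d) && (step k d t \in X)].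
pose DX s := [set b in B | (s != b) && (step k b s \in Y)].
pose E' := [set z in E | (N <= 4 * K * #|DY z.1|)
   && (N <= 4 * K * #|DX (step k z.2 z.1)|)].
pose lowY := [set t in Y | ~~ (N <= 4 * K * #|DY t|)].
pose lowX := [set s in X | ~~ (N <= 4 * K * #|DX s|)].
have low (D : {set F}) (S : F -> {set F}) : #|D| <= N ->
    4 * K * \sum_(t in [set t in D | ~~ (N <= 4 * K * #|S t|)]) #|S t| <= N ^ 2.
  move=> DN; rewrite big_distrr /=.
  apply: (@leq_trans (\sum_(t in [set t in D | ~~ (N <= 4 * K * #|S t|)]) N)).
    by apply: leq_sum => t /setIdP[_]; rewrite -ltnNge => /ltnW.
  rewrite sum_nat_const -mulnn leq_mul2r; apply/orP; right.
  by apply: leq_trans DN; apply: subset_leq_card; apply/subsetP => t /setIdP[].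
have EE : #|E| <= #|E'| + \sum_(t in lowY) #|DY t| + \sum_(s in lowX) #|DX s|.
  rewrite -!card_dep_pair -addnA -(cardsID E' E); apply: leq_add.
    by apply: subset_leq_card; apply: subsetIr.
  set A1 := [set z | _]; set A2 := [set z | _].
  (* An edge whose end in [X] has low degree is counted from that end: [step c] being an involution,
     [c] belongs to [DX (step c t)]. *)
  apply: (@leq_trans #|A1 :|: [set z | (z.1 != z.2) &&
      ((step k z.2 z.1, z.2) \in A2) & z.2 \in B]|).
    apply: subset_leq_card; apply/subsetP => -[t c] /setDP[].
    move=> zE; rewrite in_set zE /= negb_and.
    have [tY cB tc sX] : [/\ t \in Y, c \in B, t != c & step k c t \in X].
      by move: zE; rewrite !inE /= => /andP[/andP[-> ->] /andP[-> ->]].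
    case/orP => h; rewrite in_setU; apply/orP; [left|right].
      by rewrite in_set /=; apply/andP; split; apply/setIdP; rewrite ?tc.
    have sc := step_neq k0 (in_B_neq0 cB) tc.
    have st := stepK k0 (in_B_neq0 cB) tc.
    rewrite in_set /= tc cB andbT in_set /=; apply/andP; split; apply/setIdP=> //.
    by rewrite st sc tY.
  apply: leq_trans (leq_card_setU _ _) _; rewrite leq_add2l.
  rewrite -(@card_in_imset _ _ (fun z : F * F => (step k z.2 z.1, z.2))); last first.
    move=> [t c] [t' c']; rewrite in_set /= => /andP[/andP[tc _] cB].
    rewrite in_set /= => /andP[/andP[tc' _] cB'] [] e ec.
    rewrite -ec in e tc' *.
    by rewrite -(stepK k0 (in_B_neq0 cB) tc) e (stepK k0 (in_B_neq0 cB) tc').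
  apply: subset_leq_card; apply/subsetP => _ /imsetP[z zP ->].
  by move: zP; rewrite in_set => /andP[/andP[]].
have E'big : N ^ 2 <= 2 * K * #|E'|.
  have := low Y DY YN; have := low X DX XN; rewrite -/lowX -/lowY.
  move: EE dense; move: (\sum_(t in lowY) _) (\sum_(s in lowX) _) (#|E'|) (#|E|).
  move=> a b c d h1 h2 h3 h4; clear -h1 h2 h3 h4; nia.
have inj : \sum_(e in E') #|setX (DY e.1) (DX (step k e.2 e.1))|
    <= \sum_(w in BBB) #|walks w|.
  rewrite -!card_dep_pair.
  pose f (q : (F * F) * (F * F)) := (((q.2.2, q.1.2), q.2.1), step k q.2.1 q.1.1).
  rewrite -(@card_in_imset _ _ f); last first.
    move=> [[t c] [d b]] [[t' c'] [d' b']].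
    rewrite in_set /= => /andP[_ /setXP[/= /setIdP[dB /andP[td _]] _]].
    rewrite in_set /= => /andP[_ /setXP[/= /setIdP[dB' /andP[td' _]] _]].
    case=> -> -> e; rewrite -e in td' * => et.
    by rewrite -(stepK k0 (in_B_neq0 dB) td) et (stepK k0 (in_B_neq0 dB) td').
  apply: subset_leq_card; apply/subsetP => _ /imsetP[[[t c] [d b]] + ->].
  rewrite in_set /= => /andP[/setIdP[/setIdP[/setXP[/= tY cB] /andP[tc sX]] _]].
  case/setXP => /= /setIdP[dB /andP[td xX]] /setIdP[bB /andP[sb yY]].
  rewrite in_set /f /= !in_setX /= bB cB dB /= in_set xX /walkable /walk /=.
  have xd := step_neq k0 (in_B_neq0 dB) td.
  by rewrite (stepK k0 (in_B_neq0 dB) td) xd tc sb tY sX yY.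
have big : 16 * K ^ 2 * (\sum_(e in E') #|setX (DY e.1) (DX (step k e.2 e.1))|)
    >= #|E'| * N ^ 2.
  rewrite -sum_nat_const big_distrr /=; apply: leq_sum => e /setIdP[_ /andP[h1 h2]].
  rewrite cardsX -mulnn; apply: leq_trans (leq_mul h1 h2) _.
  by apply: eq_leq; ring.
apply: (@leq_trans (2 * K * #|E'| * N ^ 2)).
  by rewrite (_ : N ^ 4 = N ^ 2 * N ^ 2) ?leq_mul2r ?E'big ?orbT //; ring.
apply: (@leq_trans (2 * K * (16 * K ^ 2 * (\sum_(w in BBB) #|walks w|)))).
  rewrite -mulnA leq_mul2l; apply/orP; right; apply: (leq_trans big).
  by rewrite leq_mul2l inj orbT.
by apply: eq_leq; ring.
Qed.

(** A bad word has two equal letters or [wR = 0], which for [b != c] is a linear equation in [d]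
    with coefficient [c - b]. Each of the four cases is an image of [B * B]. *)
Lemma card_bad_words : #|[set w in BBB | ~~ good_word k w]| <= 4 * N ^ 2.
Proof.
have BB : #|setX B B| <= N ^ 2 by rewrite cardsX -mulnn leq_mul.
have img (f : F * F -> F * F * F) : #|f @: setX B B| <= N ^ 2.
  exact: leq_trans (leq_imset_card _ _) BB.
pose A1 := (fun z : F * F => ((z.1, z.1), z.2)) @: setX B B.
pose A2 := (fun z : F * F => ((z.1, z.2), z.2)) @: setX B B.
pose A3 := (fun z : F * F => ((z.1, z.2), z.1)) @: setX B B.
pose A4 := (fun z : F * F =>
  ((z.1, z.2), - (z.2 * (z.1 - (1 - k) * z.2)) / (z.2 - z.1))%R) @: setX B B.
apply: (@leq_trans #|A1 :|: A2 :|: A3 :|: A4|); last first.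
  rewrite (_ : 4 * N ^ 2 = N ^ 2 + N ^ 2 + N ^ 2 + N ^ 2); last by ring.
  do 3! [apply: leq_trans (leq_card_setU _ _) _; apply: leq_add; last exact: img].
  exact: img.
apply: subset_leq_card; apply/subsetP => -[[b c] d] /setIdP[/setXP[/= /setXP[/= bB cB] dB]].
rewrite /good_word /= (in_B_neq0 bB) (in_B_neq0 cB) (in_B_neq0 dB) /= !negb_and !negbK.
case: (eqVneq b c) => [->|bc] /=.
  by rewrite !inE => _; rewrite (_ : _ \in A1) //; apply/imsetP; exists (c, d); rewrite ?inE ?cB.
case: (eqVneq c d) => [<-|cd] /=.
  rewrite !inE => _; rewrite (_ : _ \in A2) ?orbT //.
  by apply/imsetP; exists (b, c); rewrite ?inE ?bB.
case: (eqVneq b d) => [<-|bd] /=.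
  rewrite !inE => _; rewrite (_ : _ \in A3) ?orbT //.
  by apply/imsetP; exists (b, c); rewrite ?inE ?bB.
move=> /eqP R0; rewrite !inE (_ : _ \in A4) ?orbT //.
apply/imsetP; exists (b, c); rewrite ?inE ?bB //=; congr (_, _).
have cb0 : (c - b != 0)%R by rewrite subr_eq0 eq_sym.
apply: (mulfI cb0); rewrite mulrC mulrCA mulfV // mulr1 mulrC.
apply/eqP; rewrite -subr_eq0 -R0 /wR; apply/eqP; ring.
Qed.
End Counting.

(** * From walks to affine relations *)

Section Lambda.
Variables (F : finFieldType) (k : F).
Hypotheses (k0 : k != 0%R) (k1 : k != 1%R) (two0 : (2%:R != 0 :> F)%R).
Variables (X Y B : {set F}) (N K : nat).
Hypotheses (XN : #|X| <= N) (YN : #|Y| <= N) (BN : #|B| <= N) (B0 : 0%R \notin B).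
Hypothesis dense : N ^ 2 <=
  K * #|[set z in setX Y B | (z.1 != z.2) && (step k z.2 z.1 \in X)]|.
Hypothesis (Nbig : 768 * K ^ 3 <= N).
Hypothesis (N0 : 0 < N).

Let W := walks k X Y.
Let L := 128 * K ^ 3.

(** Bad words carry at most [4 N ^ 3] walks in total, a small part of the total by [Nbig]; averaging
    over the good words does the rest. *)
Lemma popular_words : exists P : {set F * F * F},
  [/\ {in P, forall w, good_word k w /\ N <= L * #|W w|} & N ^ 3 <= L * #|P|].
Proof.
pose BBB := setX (setX B B) B.
pose G := [set w in BBB | good_word k w].
have WN w : #|W w| <= N.
  apply: leq_trans XN; apply: subset_leq_card; apply/subsetP => x.
  by move/setIdP => [].
have h1 := many_walks k0 XN YN B0 dense.
have h2 : \sum_(w in BBB) #|W w| <= 4 * N ^ 3 + \sum_(w in G) #|W w|.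
  rewrite (big_setID G) /= addnC; apply: leq_add; last first.
    apply/eq_leq/eq_bigl => w; rewrite [G]setIdE in_setI in_setI.
    by case: (w \in BBB).
  apply: (@leq_trans (#|BBB :\: G| * N)).
    by rewrite -sum_nat_const; apply: leq_sum.
  rewrite (_ : 4 * N ^ 3 = 4 * N ^ 2 * N); last by ring.
  rewrite leq_mul2r; apply/orP; right; apply: leq_trans (card_bad_words k BN B0).
  apply: subset_leq_card; apply/subsetP => w /setDP[wB wG]; apply/setIdP.
  by split=> //; apply: contra wG => gw; apply/setIdP.
have G3 : #|G| <= N ^ 3.
  apply: (@leq_trans #|BBB|).
    by apply: subset_leq_card; apply/subsetP => w /setIdP[].
  rewrite !cardsX (_ : N ^ 3 = N * N * N) ?leq_mul //; ring.
pose P := [set w in G | N <= L * #|W w|].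
exists P; split; first by move=> w /setIdP[/setIdP[_ ->] ->].
have h3 := sum_popular (fun w => #|W w|) L N G3.
have h4 : \sum_(w in P) #|W w| <= #|P| * N.
  by rewrite -sum_nat_const; apply: leq_sum.
rewrite -(leq_pmul2r N0).
move: h1 h2 h3 h4; rewrite -/BBB -/P -/W /L.
move: (\sum_(w in BBB) _) (\sum_(w in G) _) (\sum_(w in P) _) (#|P|) => a b c q.
have e3 : N ^ 4 = N ^ 3 * N by ring.
have e4 : 256 * K ^ 3 * N ^ 3 <= N ^ 3 * N.
  rewrite [X in X <= _]mulnC leq_mul2l; apply/orP; right; lia.
rewrite e3; move: Nbig e4; move: (N ^ 3) (K ^ 3) => n3 k3 Nb e4 h1 h2 h3 h4.
have h5 : 32 * k3 * a <= 32 * k3 * (4 * n3 + b) by rewrite leq_mul2l h2 orbT.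
have h6 : 128 * k3 * c <= 128 * k3 * (q * N) by rewrite leq_mul2l h4 orbT.
lia.
Qed.

Lemma W_walkable w x : x \in W w -> [/\ x \in X, walkable k w x & walk k w x \in Y].
Proof. by move=> /setIdP[-> /and4P[-> _ _ ->]]. Qed.

(** Popular choices of [x0], its image [y0], [x1] and [x2] leave about [N ^ 2] words defined at all
    three points. Such a word [w] and a further point [x] give by [walk_affine] a relation with
    ratio [lam x] between points of [Y']. The ratio determines [x], and the images of [x0], [x1],
    [x2] determine the Moebius map, so each relation arises at most 12 times. *)
Lemma affine_family_of_walks : exists Y' L' : {set F},
  [/\ #|Y'| <= N, #|L'| <= N, 0%R \notin L', 1%R \notin L' &
  N ^ 3 <= 96 * 128 ^ 5 * K ^ 15 * \sum_(l in L')
    #|[set z in setX Y' Y' | (l * z.1 + (1 - l) * z.2)%R \in Y']| ].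
Proof.
have [P [PW PN]] := popular_words.
have K0 : 0 < K.
  rewrite lt0n; apply: contraTneq dense => ->.
  by rewrite mul0n -ltnNge expn_gt0 N0.
have P0 : 0 < #|P|.
  by rewrite lt0n; apply: contraTneq PN => ->; rewrite muln0 -ltnNge expn_gt0 N0.
have L0 : 0 < L by rewrite muln_gt0 expn_gt0 K0.
(* Here [768 = 6 * 128]. With six points in [W w], deleting up to three leaves at least half. *)
have W6 w : w \in P -> 6 <= #|W w|.
  move=> /PW[_ h]; rewrite -(leq_pmul2l L0); apply: leq_trans h.
  by apply: leq_trans Nbig; rewrite /L; lia.
have Wdel w (A : {set F}) : w \in P -> #|A| <= 3 -> N <= 2 * L * #|W w :\: A|.
  move=> wP A3; have [_ h] := PW _ wP; have h6 := W6 _ wP.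
  apply: (leq_trans h); rewrite [2 * L]mulnC -mulnA leq_mul2l; apply/orP; right.
  have := subset_leq_card (subsetIr (W w) A); have := cardsID A (W w); lia.
have WX w : W w \subset X by apply/subsetP => x /W_walkable[].
have [x0 x0X h1] : exists2 x, x \in X & #|P| <= L * #|[set w in P | x \in W w]|.
  by apply: (popular_point XN P0 N0) => w /PW[_ h].
set P1 := [set w in P | _] in h1.
have P10 : 0 < #|P1|.
  by rewrite lt0n; apply: contraTneq h1 => ->; rewrite muln0 -ltnNge.
have P1Y : {in P1, forall w, walk k w x0 \in Y}.
  by move=> w /setIdP[_ /W_walkable[]].
have [y0 y0Y h2] := pigeonhole P10 P1Y.
set P2 := [set w in P1 | _] in h2.
have P20 : 0 < #|P2|.
  by rewrite lt0n; apply: contraTneq h2 => ->; rewrite muln0 -ltnNge.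
have P2P : {subset P2 <= P} by move=> w /setIdP[/setIdP[]].
have [x1 x1X h3] : exists2 x, x \in X &
    #|P2| <= 2 * L * #|[set w in P2 | x \in W w :\: [set x0]]|.
  apply: (popular_point XN P20 N0) => w /P2P wP; split.
    by apply: subset_trans (subsetDl _ _) (WX w).
  by apply: Wdel => //; rewrite cards1.
set P3 := [set w in P2 | _] in h3.
have P30 : 0 < #|P3|.
  by rewrite lt0n; apply: contraTneq h3 => ->; rewrite muln0 -ltnNge.
have P3P : {subset P3 <= P} by move=> w /setIdP[/P2P].
have [x2 x2X h4] : exists2 x, x \in X &
    #|P3| <= 2 * L * #|[set w in P3 | x \in W w :\: [set x0; x1]]|.
  apply: (popular_point XN P30 N0) => w /P3P wP; split.
    by apply: subset_trans (subsetDl _ _) (WX w).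
  by apply: Wdel => //; rewrite cards2; case: (_ != _).
set P4 := [set w in P3 | _] in h4.
have P4P : {subset P4 <= P} by move=> w /setIdP[/P3P].
pose A w := W w :\: [set x0; x1; x2].
have h5 : #|P4| * N <= 2 * L * \sum_(w in P4) #|A w|.
  rewrite -sum_nat_const big_distrr /=; apply: leq_sum => w /P4P wP.
  apply: Wdel => //; apply: leq_trans (leq_card_setU _ _) _.
  by rewrite cards1 cards2; case: (_ != _).
have total : N ^ 3 <= 8 * L ^ 5 * \sum_(w in P4) #|A w|.
  have h2' : #|P1| <= N * #|P2|.
    by apply: (leq_trans h2); rewrite leq_mul2r YN orbT.
  have g1 : N * N ^ 2 <= N * (L ^ 2 * #|P2|).
    have -> : N * (L ^ 2 * #|P2|) = L * (L * (N * #|P2|)) by ring.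
    rewrite -expnS; apply: (leq_trans PN); rewrite leq_mul2l; apply/orP; right.
    by apply: (leq_trans h1); rewrite leq_mul2l h2' orbT.
  rewrite leq_pmul2l // in g1.
  have g2 : N ^ 2 <= L ^ 2 * (2 * L * (2 * L * #|P4|)).
    apply: (leq_trans g1); rewrite leq_mul2l; apply/orP; right.
    by apply: (leq_trans h3); rewrite leq_mul2l h4 orbT.
  apply: (@leq_trans (4 * L ^ 4 * (#|P4| * N))).
    rewrite expnSr (_ : 4 * L ^ 4 * (#|P4| * N) =
      L ^ 2 * (2 * L * (2 * L * #|P4|)) * N); last by ring.
    by rewrite leq_mul2r g2 orbT.
  apply: (@leq_trans (4 * L ^ 4 * (2 * L * \sum_(w in P4) #|A w|))).
    by rewrite leq_mul2l h5 orbT.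
  by apply: eq_leq; ring.
have P4w w : w \in P4 -> [/\ good_word k w, walk k w x0 = y0,
    [/\ x0 != x1, x0 != x2 & x1 != x2] &
    [/\ x0 \in W w, x1 \in W w & x2 \in W w]].
  move=> wP4; have [gw _] := PW _ (P4P _ wP4).
  move: wP4 => /setIdP[/setIdP[/setIdP[/setIdP[_ x0W] /eqP e0]]].
  move=> /setDP[x1W x1n] /setDP[x2W x2n].
  move: x1n x2n; rewrite in_set1 in_set2 negb_or => x10 /andP[x20 x21].
  by split=> //; split; rewrite // eq_sym.
pose u (x : F) := ((x - x0)^-1)%R.
pose lam (x : F) := ((u x - u x2) / (u x1 - u x2))%R.
pose Y' := [set ((y - y0)^-1)%R | y in Y].
pose L' := lam @: (X :\: [set x0; x1; x2]).
case: (set_0Vmem P4) => [P4E|[w0 /P4w[_ _ [x01 x02 x12] _]]].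
  move: total; rewrite P4E big_set0 muln0 => /(leq_trans _)-/(_ 1).
  by rewrite expn_gt0 N0 => /(_ isT).
have du : (u x1 - u x2 != 0)%R.
  by rewrite subr_eq0; apply: contra x12 => /eqP/invr_inj/addIr ->.
have lam_inj : injective lam.
  move=> a b /(mulIf (invr_neq0 du)) /addIr /invr_inj /addIr.
  exact.
exists Y', L'; split.
- exact: leq_trans (leq_imset_card _ _) YN.
- apply: leq_trans (leq_imset_card _ _) _.
  by apply: leq_trans (subset_leq_card (subsetDl _ _)) XN.
- apply/imsetP => -[x /setDP[_ xn]].
  have <- : lam x2 = 0%R by rewrite /lam subrr mul0r.
  by move/lam_inj => e; rewrite -e !inE eqxx !orbT in xn.
- apply/imsetP => -[x /setDP[_ xn]].
  have <- : lam x1 = 1%R by rewrite /lam mulfV.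
  by move/lam_inj => e; rewrite -e !inE eqxx !orbT in xn.
pose f l := #|[set z in setX Y' Y' | (l * z.1 + (1 - l) * z.2)%R \in Y']|.
rewrite -[X in 96 * _ * _ * X]/(\sum_(l in L') f l).
have fibers : \sum_(w in P4) #|A w| <= 12 * \sum_(l in L') f l.
  rewrite -!card_dep_pair.
  pose v (w : F * F * F) (x : F) := ((walk k w x - y0)^-1)%R.
  have vY w x : walk k w x \in Y -> v w x \in Y'.
    by move=> yY; apply/imsetP; exists (walk k w x).
  apply: (@card_le_fibers _ _ _ _
    (fun q => (lam q.2, (v q.1 x1, v q.1 x2)))).
    move=> [w x]; rewrite in_set => /andP[/= wP4 /setDP[xW xn]].
    have [gw e0 _ [x0W x1W x2W]] := P4w _ wP4.
    have [xX wkx yx] := W_walkable xW.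
    have [_ wk0 _] := W_walkable x0W.
    have [_ wk1 y1] := W_walkable x1W.
    have [_ wk2 y2] := W_walkable x2W.
    rewrite in_set /=; apply/andP; split.
      by apply/imsetP; exists x => //; apply/setDP.
    rewrite in_set in_setX /= !vY //=.
    have x0x : x0 != x by apply: contraNneq xn => ->; rewrite !inE eqxx.
    have := @walk_affine _ _ k0 w x0 x1 x2 x gw x01 x02 x0x x12.
    rewrite e0 => ->; first exact: vY.
    by move=> z; rewrite !inE => /or4P[] /eqP ->.
  move=> [l [a b]] _.
  set Fb := [set q in _ | _].
  case: (set_0Vmem Fb) => [->|[[w1 xx]]]; first by rewrite cards0.
  move=> /setIdP[]; rewrite in_set /= => /andP[w1P4 _] /eqP[lE aE bE].
  apply: leq_trans (card_good_words k0 k1 two0 (mobius k w1)).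
  have Fbinj : {in Fb &, injective (fun q => q.1)}.
    move=> [w x] [w' x'] /setIdP[_ /eqP[ex _ _]] /setIdP[_ /eqP[ex' _ _]] /= ->.
    by congr (_, _); apply: lam_inj; rewrite ex ex'.
  rewrite -(card_in_imset Fbinj); apply: subset_leq_card.
  apply/subsetP => _ /imsetP[[w x] /setIdP[] + + ->] /=.
  rewrite in_set /= => /andP[wP4 _] /eqP[_ wa wb].
  have [gw e0 _ [x0W x1W x2W]] := P4w _ wP4.
  have [gw1 e01 _ [x0W1 x1W1 x2W1]] := P4w _ w1P4.
  rewrite in_set gw /=; apply/eqP.
  apply: (mobius_inj3 k0 gw gw1 x01 x02 x12) => z; rewrite !inE.
  case/or3P => /eqP ->; split; rewrite ?e0 ?e01 //;
    try by [have [] := W_walkable x0W|have [] := W_walkable x1W|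
      have [] := W_walkable x2W|have [] := W_walkable x0W1|
      have [] := W_walkable x1W1|have [] := W_walkable x2W1].
  - by move: wa; rewrite -aE => /invr_inj/addIr.
  - by move: wb; rewrite -bE => /invr_inj/addIr.
apply: (leq_trans total).
apply: (@leq_trans (8 * L ^ 5 * (12 * \sum_(l in L') f l))).
  by rewrite leq_mul2l fibers orbT.
rewrite /L expnMn -expnM; move: (128 ^ 5) => a; apply: eq_leq; ring.
Qed.
End Lambda.

(** * Central binomial coefficients and Catalan numbers *)

Lemma step_family_bound : exists e : nat,
  forall (p N K : nat) (k : 'F_p) (X Y B : {set 'F_p}),
  prime p -> 1 < K -> k != 0%R -> k != 1%R -> (2%:R != 0 :> 'F_p)%R ->
  #|X| <= N -> #|Y| <= N -> #|B| <= N -> 0%R \notin B ->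
  N ^ 2 <= K * #|[set z in setX Y B | (z.1 != z.2) && (step k z.2 z.1 \in X)]| ->
  N ^ 2 <= K * p -> p <= 4 * N ^ 2 -> p <= K ^ e.
Proof.
have [e eP] := affine_family_bound; exists (28 + 57 * e).
move=> p N K k X Y B p_pr K1 k0 k1 two0 XN YN BN B0 dense Np pN.
have K0 : 0 < K by apply: ltnW.
have twoK n : 2 ^ n <= K ^ n by case: n => // n; rewrite leq_exp2r.
have N0 : 0 < N.
  by rewrite lt0n; apply: contraTneq pN => ->; rewrite -ltnNge prime_gt0.
have [Nbig|Nsmall] := leqP (768 * K ^ 3) N; last first.
  apply: (@leq_trans (K ^ 28)); last by rewrite leq_exp2l // leq_addr.
  apply: (leq_trans pN); apply: (@leq_trans (4 * (768 * K ^ 3) ^ 2)).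
    by rewrite leq_mul2l leq_exp2r // ltnW.
  apply: (@leq_trans (2 ^ 2 * ((2 ^ 10) * K ^ 3) ^ 2)).
    by rewrite leq_mul // leq_exp2r // leq_mul2r orbT.
  rewrite expnMn -!expnM mulnA -expnD (expnD K 22 6) leq_mul2r.
  by rewrite twoK orbT.
have [Y' [L' [h1 h2 h3 h4 h5]]] := affine_family_of_walks k0 k1 two0 XN YN BN B0 dense Nbig N0.
(* The numerical factor is at most [2 ^ 42], hence at most [K ^ 42]. *)
have K57 : 96 * 128 ^ 5 * K ^ 15 <= K ^ 57.
  rewrite (expnD K 42 15) leq_mul2r; apply/orP; right.
  apply: leq_trans (twoK 42); rewrite (expnD 2 7 35) (expnM 2 7 5).
  by rewrite leq_mul2r orbT.
apply: (@leq_trans ((K ^ 57) ^ e)); last first.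
  by rewrite -expnM leq_exp2l // leq_addl.
apply: (eP p N (K ^ 57) Y' L' p_pr _ h1 h2 h3 h4 _ _ pN).
- by rewrite -[X in X < _](expn0 K) ltn_exp2l.
- by apply: (leq_trans h5); rewrite leq_mul2r K57 orbT.
- apply: (leq_trans Np); rewrite leq_mul2r; apply/orP; right.
  by rewrite -[X in X <= _]expn1 leq_exp2l.
Qed.

(* With [a, b, c] three consecutive terms, [1 / m = (4 - b / a) / r] and
   [1 / (m + 1) = (4 - c / b) / r]; eliminating [m] leaves a quadratic relation
   between [a], [b] and [c] that has this form after dilating [a] and [c]. *)
Lemma step_recurrence (F : finFieldType) (r m a b c : F) :
  (r != 0 -> 16%:R != 0 :> F -> m != 0 -> m + 1 != 0 -> a != 0 ->
  4%:R * m - r != 0 -> m * b = (4%:R * m - r) * a ->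
  (m + 1) * c = (4%:R * (m + 1) - r) * b ->
  (4%:R + r) / 16%:R * c != b /\
  step (r ^+ 2 / 16%:R) b ((4%:R + r) / 16%:R * c) = (4%:R + r) * a)%R.
Proof.
move=> r0 n16 m0 m1 a0 d eb ec.
have Eb : (b = (4%:R * m - r) * a / m)%R.
  by apply: (mulfI m0); rewrite eb [RHS]mulrC divfK.
have Ec : (c = (4%:R * (m + 1) - r) * b / (m + 1))%R.
  by apply: (mulfI m1); rewrite ec [RHS]mulrC divfK.
have b0 : b != 0%R by rewrite Eb !mulf_neq0 ?invr_neq0.
have tb : ((4%:R + r) / 16%:R * c - b =
    b * r * (4%:R * m - r) / (16%:R * (m + 1)))%R.
  by rewrite Ec; field; rewrite m1 n16.
split; first by rewrite -subr_eq0 tb !mulf_neq0 ?invr_neq0 ?mulf_neq0.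
rewrite /step tb.
have -> : (b + r ^+ 2 / 16%:R * b ^+ 2 /
    (b * r * (4%:R * m - r) / (16%:R * (m + 1))) =
    (4%:R + r) * (m * b) / (4%:R * m - r))%R.
  by field; rewrite m1 d b0 r0 n16.
by rewrite eb; field.
Qed.

Section Recurrence.
Variables (p s : nat) (u : nat -> nat).
Hypotheses (p_pr : prime p) (p7 : 7 <= p) (s1 : s <= 1) (u0 : u 0 = 1).
Hypothesis rec : forall n, (n.+1 + s) * u n.+1 = (4 * n + 2) * u n.

Let M := p.-1 %/ 2.
Let A := residues p u.
Let v n : 'F_p := (u n)%:R%R.
(** With this [r] the factor [4 n + 2] is [4 m (n + 1) - r], which gives [rec] the form required by
    [step_recurrence]. *)
Let r : 'F_p := (4 * s + 2)%:R%R.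
Let m n : 'F_p := (n + s)%:R%R.

Lemma natr_Fp_neq0 n : ~~ (p %| n) -> (n%:R != 0 :> 'F_p)%R.
Proof. by rewrite (dvdn_pcharf (pchar_Fp p_pr)). Qed.

Lemma natr_Fp_small n : 0 < n < p -> (n%:R != 0 :> 'F_p)%R.
Proof. by move=> /andP[n0 np]; rewrite natr_Fp_neq0 // gtnNdvd. Qed.

Lemma p_halves : p = 2 * M + 1 /\ 3 <= M.
Proof.
have odd_p : odd p by case: (even_prime p_pr) p7 => [->|].
have e : p = 2 * M + 1.
  rewrite /M; have := divn_eq p.-1 2; rewrite modn2.
  by case: p p_pr p7 odd_p => // q _ _ /= /negbTE ->; lia.
by split=> //; lia.
Qed.

Lemma m_neq0 n : 0 < n <= M -> m n != 0%R.
Proof.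
have [e M3] := p_halves; move=> /andP[n0 nM]; apply: natr_Fp_small; lia.
Qed.

Lemma recF n : (m n.+1 * v n.+1 = (4%:R * m n.+1 - r) * v n)%R.
Proof.
rewrite /m /v /r -natrM rec natrM; congr (_ * _)%R.
by rewrite -natrM -natrB; [congr (_%:R)%R; lia | lia].
Qed.

Lemma v_neq0 n : n <= M -> v n != 0%R.
Proof.
have [e M3] := p_halves.
elim: n => [|n IH] nM; first by rewrite /v u0 oner_neq0.
have h : (m n.+1 * v n.+1 != 0)%R.
  rewrite /m /v -natrM rec natrM mulf_neq0 //; last by apply: IH; lia.
  rewrite (_ : 4 * n + 2 = 2 * (2 * n + 1)); last by lia.
  by rewrite natrM mulf_neq0 //; apply: natr_Fp_small; lia.
by move: h; rewrite mulf_eq0 negb_or => /andP[].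
Qed.

(** For [s = 0, 1] the value of [r] is 2 or 6, that of [4 + r] is 6 or 10, and that of [4 - r] is 2
    or -2; only the primes 2, 3, 5 occur, and [7 <= p]. *)
Lemma r_facts : [/\ r != 0%R, (4%:R + r != 0)%R, (4%:R - r != 0)%R &
  (16%:R != 0 :> 'F_p)%R].
Proof.
have two : (2%:R != 0 :> 'F_p)%R by apply: natr_Fp_small; lia.
have five : (5%:R != 0 :> 'F_p)%R by apply: natr_Fp_small; lia.
have three : (3%:R != 0 :> 'F_p)%R by apply: natr_Fp_small; lia.
have e16 : (16%:R = 2%:R ^+ 4 :> 'F_p)%R by rewrite -natrX.
rewrite e16 expf_neq0 // /r; case: s s1 => [|[|//]] _; split=> //.
- by rewrite -natrD (natrM _ 2 3) mulf_neq0.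
- by rewrite (_ : _ - _ = 2%:R)%R //; ring.
- by rewrite (natrM _ 2 3) mulf_neq0.
- by rewrite -natrD (natrM _ 2 5) mulf_neq0.
- by rewrite (_ : _ - _ = - 2%:R)%R ?oppr_eq0 //; ring.
Qed.

Lemma mem_residues n : n <= M -> v n \in A.
Proof.
by rewrite -ltnS => nM; apply/imsetP; exists (Ordinal nM).
Qed.

Lemma many_steps :
  M.-1 <= #|[set z in setX (dilate ((4%:R + r) / 16%:R)%R A) A |
    (z.1 != z.2) &&
    (step (r ^+ 2 / 16%:R)%R z.2 z.1 \in dilate (4%:R + r)%R A)]|.
Proof.
have [e M3] := p_halves; have [r0 r4 r4' n16] := r_facts.
have vA (i : 'I_(M.-1)) : [/\ v i \in A, v i.+1 \in A & v i.+2 \in A].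
  have iM : i.+2 <= M by have := ltn_ord i; lia.
  by split; apply: mem_residues => //; apply: ltnW => //; apply: ltnW.
have ip (i : 'I_(M.-1)) : i.+2 + s < p by have := ltn_ord i; lia.
pose f (i : 'I_(M.-1)) := (((4%:R + r) / 16%:R * v i.+2)%R, v i.+1).
have facts (i : 'I_(M.-1)) : [/\ m i.+1 != 0%R, m i.+2 != 0%R, v i != 0%R,
    v i.+1 != 0%R & (4%:R * m i.+1 - r != 0)%R].
  have iM := ltn_ord i.
  have n1 : v i.+1 != 0%R by apply: v_neq0; lia.
  have m1 : m i.+1 != 0%R by apply: m_neq0; lia.
  split=> //; [by apply: m_neq0; lia | by apply: v_neq0; lia|].
  have : (m i.+1 * v i.+1 != 0)%R by rewrite mulf_neq0.
  by rewrite recF mulf_eq0 negb_or => /andP[].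
have mS n : (m n.+1 = m n + 1)%R by rewrite /m addSn -natr1.
(* The ratio of consecutive terms is [4 - r / m i.+2], so a pair determines [m i.+2] and hence [i],
   as the integers involved are below [p]. *)
have f_inj : injective f.
  move=> i j fij; have e1 : v i.+1 = v j.+1 := congr1 snd fij.
  have c0 : ((4%:R + r) / 16%:R != 0)%R by rewrite mulf_neq0 ?invr_neq0.
  have e2 : v i.+2 = v j.+2 := mulfI c0 (congr1 fst fij).
  have [mi1 mi2 vi vi1 _] := facts i; have [mj1 mj2 vj vj1 _] := facts j.
  have : (r * v i.+1 * m j.+2 = r * v i.+1 * m i.+2)%R.
    have ei := recF i.+1; have ej := recF j.+1.
    have hi : (r * v i.+1 = m i.+2 * (4%:R * v i.+1 - v i.+2))%R.
      by rewrite mulrBr ei; ring.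
    have hj : (r * v i.+1 = m j.+2 * (4%:R * v i.+1 - v i.+2))%R.
      by rewrite e1 e2 mulrBr ej; ring.
    by rewrite {1}hi hj; ring.
  have rv : (r * v i.+1 != 0)%R by rewrite mulf_neq0.
  move/(mulfI rv)/(congr1 (fun x : 'F_p => x : nat)).
  rewrite /m !val_Fp_nat // !modn_small ?ip // => /addIn[].
  by move=> h; apply: val_inj.
rewrite -[X in X <= _]card_ord -(card_imset _ f_inj).
apply: subset_leq_card; apply/subsetP => _ /imsetP[i _ ->].
have [m1 m2 vi vi1 d] := facts i; have [vA0 vA1 vA2] := vA i.
rewrite mS in m2.
have := recF i.+1; rewrite mS => ec.
have [tb st] := step_recurrence r0 n16 m1 m2 vi d (recF i) ec.
apply/setIdP; split.
  by apply/setXP; split=> //; apply: imset_f.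
apply/andP; split; first exact: tb.
have : ((4%:R + r) * v i)%R \in dilate (4%:R + r)%R A by apply: imset_f.
by rewrite -st.
Qed.

Lemma card_residues_ge : p <= 4 * #|A| ^ 2.
Proof.
have [e M3] := p_halves; have := many_steps.
set Z := [set z in _ | _] => h.
have : #|Z| <= #|A| ^ 2.
  apply: (@leq_trans #|setX (dilate ((4%:R + r) / 16%:R)%R A) A|).
    by apply: subset_leq_card; apply/subsetP => z /setIdP[].
  by rewrite cardsX -mulnn leq_mul2r leq_imset_card orbT.
move: h; move: (#|Z|) (#|A| ^ 2) => a b; clear -M3 e; lia.
Qed.

Lemma residues_bound (e : nat) :
  (forall (N K : nat) (k : 'F_p) (X Y B : {set 'F_p}),
  1 < K -> k != 0%R -> k != 1%R -> (2%:R != 0 :> 'F_p)%R ->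
  #|X| <= N -> #|Y| <= N -> #|B| <= N -> 0%R \notin B ->
  N ^ 2 <= K * #|[set z in setX Y B | (z.1 != z.2) && (step k z.2 z.1 \in X)]| ->
  N ^ 2 <= K * p -> p <= 4 * N ^ 2 -> p <= K ^ e) ->
  p ^ e.+2 <= (4 * #|A|) ^ (2 * e.+1).
Proof.
move=> bound; have [r0 r4 r4' n16] := r_facts; have [eM M3] := p_halves.
have pN := card_residues_ge; set N := #|A| in pN *.
have p0 : 0 < p by apply: prime_gt0.
pose K := (4 * N ^ 2) %/ p + 2.
have K1 : 1 < K by rewrite /K addn2.
have NK : 4 * N ^ 2 <= K * p.
  rewrite /K mulnDl; have := ltn_ceil (4 * N ^ 2) p0.
  rewrite [_.+1 * p]mulSn; move: (4 * N ^ 2) => n; move: (n %/ p * p) => q.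
  clear; lia.
have Kp : K * p <= 16 * N ^ 2.
  rewrite /K mulnDl; have := leq_trunc_div (4 * N ^ 2) p; move: pN.
  by move: (N ^ 2) => n; move: (_ %/ _ * p) => q; clear; lia.
have AM : N ^ 2 <= K * M.-1.
  have h : 4 * N ^ 2 <= 4 * (K * M.-1).
    apply: (leq_trans NK); rewrite mulnCA leq_mul2l; apply/orP; right.
    by clear -M3 eM; lia.
  by rewrite leq_pmul2l in h.
have : p <= K ^ e.
  apply: (bound N K (r ^+ 2 / 16%:R)%R (dilate (4%:R + r)%R A)
    (dilate ((4%:R + r) / 16%:R)%R A) A) => //.
  - by rewrite mulf_neq0 ?invr_neq0 ?expf_neq0.
  - rewrite -subr_eq0 (_ : _ - 1 = (r ^+ 2 - 16%:R) / 16%:R)%R; last first.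
      by rewrite mulrBl mulfV.
    rewrite mulf_neq0 ?invr_neq0 //.
    have -> : (r ^+ 2 - 16%:R = - ((4%:R - r) * (4%:R + r)))%R by ring.
    by rewrite oppr_eq0 mulf_neq0.
  - by apply: natr_Fp_small; lia.
  - exact: leq_imset_card.
  - exact: leq_imset_card.
  - by apply/imsetP => -[i _ /eqP]; rewrite eq_sym (negbTE (v_neq0 _)) // -ltnS.
  - apply: (leq_trans AM); rewrite leq_mul2l; apply/orP; right.
    exact: many_steps.
  - by apply: leq_trans NK; rewrite leq_pmull.
move=> pK; have {}pK : p <= K ^ e.+1.
  by apply: (leq_trans pK); rewrite leq_exp2l.
rewrite expnS; apply: (@leq_trans (K ^ e.+1 * p ^ e.+1)).
  by rewrite leq_mul2r pK orbT.
rewrite -expnMn expnM leq_exp2r //; apply: (leq_trans Kp).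
by rewrite expnMn.
Qed.

End Recurrence.

Lemma central_binomial_rec n :
  n.+1 * 'C(2 * n.+1, n.+1) = (4 * n + 2) * 'C(2 * n, n).
Proof.
apply/eqP; rewrite -(eqn_pmul2l (ltn0Sn n)); apply/eqP.
have h1 := mul_bin_diag (2 * n.+1) n; have h2 := mul_bin_diag (2 * n).+1 n.
have h3 : 'C((2 * n).+1, n) = 'C((2 * n).+1, n.+1).
  by rewrite -bin_sub; [congr 'C(_, _); lia | lia].
rewrite (_ : (2 * n.+1).-1 = (2 * n).+1) in h1; last by lia.
rewrite /= in h2; rewrite -h1 h3 mulnCA -h2; lia.
Qed.

Lemma catalan_rec n : (n.+1 + 1) * catalan n.+1 = (4 * n + 2) * catalan n.
Proof.
have h1 := catalan_mul n; have h2 := catalan_mul n.+1.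
have h3 := central_binomial_rec n.
apply/eqP; rewrite -(eqn_pmul2l (ltn0Sn n)) addn1 [n.+2 * _]mulnC h2 h3.
by rewrite -h1; apply/eqP; ring.
Qed.

Local Open Scope ring_scope.

(** Extract the root of order [2 (e + 1)]: this order times [1 / 2 + 1 / (2 (e + 1))] is [e + 2]. *)
Lemma powR_bound (R : realType) (p N e : nat) :
  (p ^ e.+2 <= (4 * N) ^ (2 * e.+1))%N ->
  4^-1 * p%:R `^ (1 / 2 + (2 * e.+1)%:R^-1) <= N%:R :> R.
Proof.
move=> h; rewrite mulrC ler_pdivrMr // [_ * 4]mulrC -natrM.
set w := (1 / 2 + _).
have ew : w * (2 * e.+1)%:R = e.+2%:R.
  rewrite /w mulrDl mulVf ?pnatr_eq0 // natrM -[e.+2]addn1 natrD.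
  by congr (_ + _); rewrite mulrA divfK ?pnatr_eq0 // mul1r.
have : (p%:R `^ w) ^+ (2 * e.+1) = (p%:R : R) ^+ e.+2.
  by rewrite -powR_mulrn ?powR_ge0 // -powRrM ew powR_mulrn.
move=> E; rewrite -(ler_pXn2r (n := 2 * e.+1)) ?nnegrE ?powR_ge0 // E.
by rewrite -!natrX ler_nat.
Qed.

Theorem theorem1p5 (R : realType) :
  exists c eta : R,
    [/\ 0 < c, 0 < eta &
      forall p : nat, prime p -> (7 <= p)%N ->
        c * p%:R `^ (1 / 2 + eta) <= #|residues p catalan|%:R /\
        c * p%:R `^ (1 / 2 + eta)
          <= #|residues p (fun n : nat => 'C(2 * n, n))|%:R].
Proof.
have [e bound] := step_family_bound.
exists 4^-1, (2 * e.+1)%:R^-1; split; rewrite ?invr_gt0 ?ltr0n // => p p_pr p7.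
have bp N K k X Y B := bound p N K k X Y B p_pr.
split; apply: powR_bound.
  (* The shift [s] is 1 for the Catalan numbers and 0 for the central binomial coefficients. *)
  exact: (residues_bound p_pr p7 (leqnn 1) _ catalan_rec bp).
apply: (residues_bound p_pr p7 (leq0n 1) _ _ bp) => // n.
by rewrite addn0 central_binomial_rec.
Qed.
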